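(* Let $\phi\colon L\to N$ be a morphism of differential graded Lie algebras over a field $\mathbb{K}$ of characteristic $0$, and denote by $H^i(\phi)\colon H^i(L)\to H^i(N)$ the induced maps in cohomology. \begin{enumerate} \item If $H^1(\phi)$ is surjective and $H^2(\phi)$ is injective, then the morphism $\mathrm{Def}_\phi\colon\mathrm{Def}_L\to\mathrm{Def}_N$ is smooth. \item If $H^0(\phi)$ is surjective, $H^1(\phi)$ is bijective and $H^2(\phi)$ is injective, then $\mathrm{Def}_\phi\colon\mathrm{Def}_L\to\mathrm{Def}_N$ is an isomorphism. \end{enumerate}
   Context: A differential graded Lie algebra (DGLA) is a $\mathbb{Z}$-graded vector space $L=\oplus_i L^i$ with a homogeneous graded-skewsymmetric bracket satisfying the graded Jacobi identity and a differential $d$ of degree $+1$ with $d[a,b]=[da,b]+(-1)^{\bar a}[a,db]$. $\mathrm{Art}_{\mathbb{K}}$ is the category of local Artinian $\mathbb{K}$-algebras with residue field $\mathbb{K}$ (and local homomorphisms); $\mathfrak{m}_A$ is the maximal ideal of $A$. For $A\in\mathrm{Art}_{\mathbb{K}}$ put $MC_L(A)=\{x\in L^1\otimes\mathfrak{m}_A\mid dx+\frac12[x,x]=0\}$. The group $\exp(L^0\otimes\mathfrak{m}_A)$ (the nilpotent Lie algebra $L^0\otimes\mathfrak{m}_A$ with the Baker-Campbell-Hausdorff product) acts on $MC_L(A)$ by the gauge action $\exp(a)(x)=x+\sum_{n\ge 0}\frac{\mathrm{ad}(a)^n}{(n+1)!}([a,x]-da)$, and $\mathrm{Def}_L(A)$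 is the quotient set. This defines a functor $\mathrm{Def}_L\colon\mathrm{Art}_{\mathbb{K}}\to\mathrm{Set}$, and $\phi$ induces a natural transformation $\mathrm{Def}_\phi$. A small extension in $\mathrm{Art}_{\mathbb{K}}$ is an exact sequence $0\to J\to B\xrightarrow{p}A\to 0$ with $p$ a morphism in $\mathrm{Art}_{\mathbb{K}}$ and $J$ annihilated by $\mathfrak{m}_B$. A natural transformation $\eta\colon F\to G$ of functors $\mathrm{Art}_{\mathbb{K}}\to\mathrm{Set}$ (with $F(\mathbb{K}),G(\mathbb{K})$ one-point sets) is smooth if for every small extension $0\to J\to B\xrightarrow{p}A\to 0$ in $\mathrm{Art}_{\mathbb{K}}$ the map $F(B)\to G(B)\times_{G(A)}F(A)$ is surjective; it is an isomorphism if it is bijective on every $A$. *)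

(* Defs.v *)
From HB Require Import structures.
From mathcomp Require Import all_boot all_order all_algebra.
From mathcomp Require Import generic_quotient.
From mathcomp Require Import boolp classical_sets functions fsbigop.

Set Implicit Arguments.
Unset Strict Implicit.
Unset Printing Implicit Defensive.

Import GRing.Theory.
Local Open Scope ring_scope.
Local Open Scope quotient_scope.
Local Open Scope classical_set_scope.

Definition bilinear_map (K : fieldType) (U V W : lmodType K)
    (f : U -> V -> W) : Prop :=
  (forall u, linear (f u)) /\ (forall v, linear (f^~ v)).

Section Tensor.
Context {K : fieldType}.

Definition formal_sum_eval (U V W : lmodType K) (f : U -> V -> W)
    (s : seq (U * V)) : W :=
  \sum_(p <- s) f p.1 p.2.

Section Quotient.
Variables U V : lmodType K.

(* A sequence of pairs (u, v) stands for the formal sum of the u (x) v.  Two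
   formal sums are equal in the tensor product iff no bilinear map separates
   them; [tens_lift_pure], [tens_lift_linear] and [tens_spanned] below give the
   universal property. *)
Definition tens_rel (s t : seq (U * V)) : bool :=
  `[< forall (W : lmodType K) (f : U -> V -> W), bilinear_map f ->
        formal_sum_eval f s = formal_sum_eval f t >].

Lemma tens_rel_refl : reflexive tens_rel.
Proof. by move=> s; apply/asboolP. Qed.

Lemma tens_rel_sym : symmetric tens_rel.
Proof.
move=> s t; apply/idP/idP => /asboolP h; apply/asboolP => W f bf;
  by rewrite (h W f bf).
Qed.

Lemma tens_rel_trans : transitive tens_rel.
Proof.
move=> t s r /asboolP st /asboolP tr; apply/asboolP => W f bf.
by rewrite (st W f bf) (tr W f bf).
Qed.

Definition tens_equiv := EquivRel tens_rel tens_rel_refl tens_rel_sym tens_rel_trans.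

Definition tens : Type := {eq_quot tens_equiv}.

HB.instance Definition _ := Choice.on tens.
HB.instance Definition _ := EqQuotient.on tens.

Definition pure (u : U) (v : V) : tens := \pi_tens [:: (u, v)].

Definition tens_lift (W : lmodType K) (f : U -> V -> W) (x : tens) : W :=
  formal_sum_eval f (repr x).

Lemma eval_repr_pi (W : lmodType K) (f : U -> V -> W) s :
  bilinear_map f -> formal_sum_eval f (repr (\pi_tens s)) = formal_sum_eval f s.
Proof.
move=> bf; have /eqmodP /asboolP -> // : repr (\pi_tens s) = s %[mod tens].
by rewrite reprK.
Qed.

Lemma tens_ext (x y : tens) :
  (forall (W : lmodType K) (f : U -> V -> W), bilinear_map f ->
     tens_lift f x = tens_lift f y) -> x = y.
Proof.
move=> h; rewrite -(reprK x) -(reprK y); apply/eqmodP/asboolP => W f bf.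
exact: h.
Qed.

Definition tens_zero : tens := \pi_tens [::].
Definition tens_add (x y : tens) : tens := \pi_tens (repr x ++ repr y).
Definition tens_scale (a : K) (x : tens) : tens :=
  \pi_tens [seq (a *: p.1, p.2) | p <- repr x].
Definition tens_opp (x : tens) : tens := tens_scale (-1) x.

Lemma lift_zero (W : lmodType K) (f : U -> V -> W) :
  bilinear_map f -> tens_lift f tens_zero = 0.
Proof.
by move=> bf; rewrite /tens_lift eval_repr_pi // /formal_sum_eval big_nil.
Qed.

Lemma lift_add (W : lmodType K) (f : U -> V -> W) x y :
  bilinear_map f -> tens_lift f (tens_add x y) = tens_lift f x + tens_lift f y.
Proof.
by move=> bf; rewrite /tens_lift eval_repr_pi // /formal_sum_eval big_cat.
Qed.

Lemma lift_scale (W : lmodType K) (f : U -> V -> W) a x :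
  bilinear_map f -> tens_lift f (tens_scale a x) = a *: tens_lift f x.
Proof.
move=> bf; rewrite /tens_lift eval_repr_pi // /formal_sum_eval big_map.
rewrite scaler_sumr; apply: eq_bigr => p _ /=.
have h := bf.2 p.2; have h0 : f 0 p.2 = 0.
  by have /= := h (-1) 0 0; rewrite scaler0 addr0 scaleN1r addNr.
by have /= := h a p.1 0; rewrite addr0 h0 addr0.
Qed.

Let liftE := (lift_add, lift_scale, lift_zero).

Lemma tens_addA : associative tens_add.
Proof. by move=> x y z; apply: tens_ext => W f bf; rewrite !liftE // addrA. Qed.

Lemma tens_addC : commutative tens_add.
Proof. by move=> x y; apply: tens_ext => W f bf; rewrite !liftE // addrC. Qed.

Lemma tens_add0 : left_id tens_zero tens_add.
Proof. by move=> x; apply: tens_ext => W f bf; rewrite !liftE // add0r. Qed.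

Lemma tens_addN : left_inverse tens_zero tens_opp tens_add.
Proof.
by move=> x; apply: tens_ext => W f bf; rewrite !liftE // scaleN1r addNr.
Qed.

HB.instance Definition _ :=
  GRing.isZmodule.Build tens tens_addA tens_addC tens_add0 tens_addN.

Lemma tens_scaleA a b x : tens_scale a (tens_scale b x) = tens_scale (a * b) x.
Proof. by apply: tens_ext => W f bf; rewrite !liftE // scalerA. Qed.

Lemma tens_scale1 : left_id 1 tens_scale.
Proof. by move=> x; apply: tens_ext => W f bf; rewrite !liftE // scale1r. Qed.

Lemma tens_scaleDr : right_distributive tens_scale +%R.
Proof. by move=> a x y; apply: tens_ext => W f bf; rewrite !liftE // scalerDr. Qed.

Lemma tens_scaleDl x : {morph tens_scale^~ x : a b / a + b}.
Proof. by move=> a b; apply: tens_ext => W f bf; rewrite !liftE // scalerDl. Qed.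

HB.instance Definition _ := GRing.Zmodule_isLmodule.Build K tens
  tens_scaleA tens_scale1 tens_scaleDr tens_scaleDl.

Lemma tens_lift_linear (W : lmodType K) (f : U -> V -> W) :
  bilinear_map f -> linear (tens_lift f).
Proof. by move=> bf a x y; rewrite lift_add // lift_scale. Qed.

Lemma tens_lift_pure (W : lmodType K) (f : U -> V -> W) u v :
  bilinear_map f -> tens_lift f (pure u v) = f u v.
Proof.
by move=> bf; rewrite /tens_lift eval_repr_pi // /formal_sum_eval big_seq1.
Qed.

Lemma pure_bilinear : bilinear_map pure.
Proof.
split=> [u|v] a x y; apply: tens_ext => W f bf.
- by rewrite (tens_lift_linear bf) !tens_lift_pure // bf.1.
- by rewrite (tens_lift_linear bf) !tens_lift_pure //; exact: bf.2.
Qed.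

Lemma tens_lift_sum (W : lmodType K) (f : U -> V -> W) (I : Type) (s : seq I)
    (F : I -> tens) :
  bilinear_map f ->
  tens_lift f (\sum_(i <- s) F i) = \sum_(i <- s) tens_lift f (F i).
Proof.
move=> bf; elim: s => [|i s ih]; first by rewrite !big_nil lift_zero.
by rewrite !big_cons lift_add // ih.
Qed.

Lemma tens_spanned (x : tens) :
  exists s : seq (U * V), x = \sum_(p <- s) pure p.1 p.2.
Proof.
exists (repr x); apply: tens_ext => W f bf.
rewrite tens_lift_sum //.
by apply: eq_bigr => p _; rewrite tens_lift_pure.
Qed.

(* For subspaces P of U and Q of V, the image of P (x) Q in U (x) V; the
   canonical map is injective since K is a field. *)
Definition subtens (P : set U) (Q : set V) : set tens :=
  [set x | exists2 s : seq (U * V), (forall p, p \in s -> P p.1 /\ Q p.2)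
                                  & x = \sum_(p <- s) pure p.1 p.2].

End Quotient.

Definition tens_map (U V U' V' : lmodType K) (f : U -> U') (g : V -> V') :
    tens U V -> tens U' V' :=
  tens_lift (fun u v => pure (f u) (g v)).

End Tensor.

Definition is_subspace (K : fieldType) (V : lmodType K) (P : set V) : Prop :=
  P 0 /\ forall (a : K) u v, P u -> P v -> P (a *: u + v).

Definition direct_sum_decomp (K : fieldType) (V : lmodType K)
    (P : int -> set V) : Prop :=
  (forall v, exists s : seq int, exists2 c : int -> V,
     (forall i, P i (c i)) & v = \sum_(i <- s) c i) /\
  (forall (s : seq int) (c : int -> V), uniq s -> (forall i, P i (c i)) ->
     \sum_(i <- s) c i = 0 -> forall i, i \in s -> c i = 0).

Record dgla (K : fieldType) := Dgla {
  dgla_sort :> lmodType K;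
  degree : int -> set dgla_sort;
  diff : {linear dgla_sort -> dgla_sort};
  bracket : dgla_sort -> dgla_sort -> dgla_sort;
  degree_subspace : forall i, is_subspace (degree i);
  degree_direct : direct_sum_decomp degree;
  bracket_bilinear : bilinear_map bracket;
  bracket_degree : forall i j a b,
    degree i a -> degree j b -> degree (i + j) (bracket a b);
  bracket_skew : forall i j a b, degree i a -> degree j b ->
    bracket a b = - ((-1 : K) ^ (i * j) *: bracket b a);
  bracket_jacobi : forall i j a b c, degree i a -> degree j b ->
    bracket a (bracket b c)
    = bracket (bracket a b) c + (-1 : K) ^ (i * j) *: bracket b (bracket a c);
  diff_degree : forall i a, degree i a -> degree (i + 1) (diff a);
  diff_diff : forall a, diff (diff a) = 0;
  diff_bracket : forall i a b, degree i a ->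
    diff (bracket a b) = bracket (diff a) b + (-1 : K) ^ i *: bracket a (diff b)
}.

Arguments diff {K d}.
Arguments degree {K d}.

Record dgla_hom (K : fieldType) (L N : dgla K) := DglaHom {
  dgla_fun :> {linear L -> N};
  dgla_fun_degree : forall i a, degree i a -> degree i (dgla_fun a);
  dgla_fun_diff : forall a, dgla_fun (diff a) = diff (dgla_fun a);
  dgla_fun_bracket : forall a b,
    dgla_fun (bracket a b) = bracket (dgla_fun a) (dgla_fun b)
}.

Definition dgla_id (K : fieldType) (L : dgla K) : dgla_hom L L :=
  @DglaHom K L L (idfun : {linear L -> L})
    (fun _ _ h => h) (fun _ => erefl) (fun _ _ => erefl).

Section Cohomology.
Context {K : fieldType}.

Section Object.
Variables (L : dgla K) (i : int).

Definition cocycle : pred L := fun z => `[< degree i z /\ diff z = 0 >].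

Definition cocycles : Type := {z : L | cocycle z}.

HB.instance Definition _ := Choice.on cocycles.

Definition cohomologous (z w : cocycles) : bool :=
  `[< exists2 b : L, degree (i - 1) b & val z - val w = diff b >].

Lemma cohomologous_refl : reflexive cohomologous.
Proof.
move=> z; apply/asboolP; exists 0; first exact: (degree_subspace L (i - 1)).1.
by rewrite subrr linear0.
Qed.

Lemma cohomologous_sym : symmetric cohomologous.
Proof.
have h z w : cohomologous z w -> cohomologous w z.
  move=> /asboolP[b hb e]; apply/asboolP; exists (- b); last first.
    by rewrite linearN -e opprB.
  have [h0 hl] := degree_subspace L (i - 1).
  by rewrite -[- b]addr0 -scaleN1r; apply: hl.
by move=> z w; apply/idP/idP; apply: h.
Qed.

Lemma cohomologous_trans : transitive cohomologous.
Proof.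
move=> w z y /asboolP[b hb e] /asboolP[c hc e']; apply/asboolP.
exists (b + c); last by rewrite linearD -e -e' addrA subrK.
have [_ hl] := degree_subspace L (i - 1).
by rewrite -[b]scale1r; apply: hl.
Qed.

Definition cohomologous_equiv := EquivRel cohomologous
  cohomologous_refl cohomologous_sym cohomologous_trans.

Definition cohomology : Type := {eq_quot cohomologous_equiv}.

HB.instance Definition _ := Choice.on cohomology.
HB.instance Definition _ := EqQuotient.on cohomology.

End Object.

Variables (L N : dgla K) (phi : dgla_hom L N) (i : int).

Lemma cocycle_hom (z : cocycles L i) : cocycle i (phi (val z)).
Proof.
have /asboolP[hz dz] := valP z; apply/asboolP; split.
  exact: dgla_fun_degree.
by rewrite -dgla_fun_diff dz linear0.
Qed.

Definition cocycle_map (z : cocycles L i) : cocycles N i :=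
  exist _ (phi (val z)) (cocycle_hom z).

Definition cohomology_map (c : cohomology L i) : cohomology N i :=
  \pi_(cohomology N i) (cocycle_map (repr c)).

Lemma cohomology_mapE (z : cocycles L i) :
  cohomology_map (\pi_(cohomology L i) z) = \pi_(cohomology N i) (cocycle_map z).
Proof.
rewrite /cohomology_map; apply/eqmodP.
have /eqmodP/asboolP[b hb e] :
  repr (\pi_(cohomology L i) z) = z %[mod cohomology L i] by rewrite reprK.
apply/asboolP; exists (phi b); first exact: dgla_fun_degree.
by rewrite /= -linearB e dgla_fun_diff.
Qed.

End Cohomology.

Arguments cohomology_map {K L N} phi i c.

Definition surjective (S T : Type) (f : S -> T) : Prop := forall y, exists x, f x = y.

Section Ideals.
Variable A : comNzRingType.

Definition is_ideal (I : set A) : Prop :=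
  [/\ I 0, forall x y, I x -> I y -> I (x + y) & forall a x, I x -> I (a * x)].

Definition is_maximal_ideal (I : set A) : Prop :=
  [/\ is_ideal I, ~ I 1 &
      forall J : set A, is_ideal J -> I `<=` J -> ~ J 1 -> J = I].

Definition artinian : Prop :=
  forall I : nat -> set A, (forall n, is_ideal (I n)) ->
    (forall n, I n.+1 `<=` I n) ->
    exists n, forall k, (n <= k)%N -> I k = I n.

End Ideals.

(* [art_residue] says that K -> A -> A / m_A is surjective; it is injective
   because 1 is not in m_A. *)
Record art (K : fieldType) := Art {
  art_sort :> comAlgType K;
  maxid : set art_sort;
  art_artinian : artinian art_sort;
  maxid_maximal : is_maximal_ideal maxid;
  maxid_unique : forall I : set art_sort, is_maximal_ideal I -> I = maxid;
  art_residue : forall a : art_sort, exists c : K, maxid (a - c%:A)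
}.

Record art_hom (K : fieldType) (A B : art K) := ArtHom {
  art_fun :> {lrmorphism A -> B};
  art_fun_local : forall a, maxid a -> maxid (art_fun a)
}.

Section ArtCategory.
Context {K : fieldType}.

Definition art_id (A : art K) : art_hom A A :=
  @ArtHom K A A (idfun : {lrmorphism A -> A}) (fun _ h => h).

Definition art_comp (A B C : art K) (g : art_hom B C) (f : art_hom A B) :
    art_hom A C :=
  @ArtHom K A C ((g \o f)%FUN : {lrmorphism A -> C})
    (fun _ h => art_fun_local g (art_fun_local f h)).

Lemma field_ideal (I : set K^o) : is_ideal I -> ~ I 1 -> I = [set 0].
Proof.
move=> [I0 _ IM] I1; apply/seteqP; split=> [x Ix /=|x /= -> //].
apply/eqP/negP => /negP x0; apply: I1.
by have := IM x^-1 x Ix; rewrite [_ * _]mulVf.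
Qed.

Lemma field_zero_ideal : is_ideal [set 0 : K^o].
Proof.
split=> //= [x y -> ->|a x ->]; first by rewrite addr0.
by rewrite mulr0.
Qed.

Lemma field_artinian : artinian K^o.
Proof.
move=> I hI dI.
have mono n k : (n <= k)%N -> I k `<=` I n.
  elim: k => [|k ih]; first by rewrite leqn0 => /eqP ->.
  rewrite leq_eqVlt => /orP[/eqP -> //|nk].
  exact: subset_trans (dI k) (ih nk).
have [[n nI]|h] := pselect (exists n, ~ I n 1).
  exists n => k nk; rewrite (field_ideal (hI n) nI).
  by apply: field_ideal => // /(mono _ _ nk).
have full n : I n = setT.
  apply/seteqP; split=> // x _; have [_ _ IM] := hI n.
  rewrite -[x]mulr1; apply: IM; apply: contrapT => nI.
  by apply: h; exists n.
by exists 0%N => k _; rewrite !full.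
Qed.

Lemma field_maximal : is_maximal_ideal [set 0 : K^o].
Proof.
split; first exact: field_zero_ideal.
  by move=> /= /eqP; rewrite oner_eq0.
by move=> J hJ _ J1; exact: field_ideal.
Qed.

Lemma field_maximal_unique (I : set K^o) :
  is_maximal_ideal I -> I = [set 0].
Proof. by move=> [hI I1 _]; exact: field_ideal. Qed.

Lemma field_residue (a : K^o) : exists c : K, [set 0 : K^o] (a - c%:A).
Proof. by exists a => /=; rewrite [a%:A]mulr1 subrr. Qed.

Definition art_field : art K :=
  Art field_artinian field_maximal field_maximal_unique field_residue.

(* The small extension 0 -> J -> B -> A -> 0 with J the kernel of p. *)
Definition small_extension (B A : art K) (p : art_hom B A) : Prop :=
  surjective p /\ (forall b j : B, maxid b -> p j = 0 -> b * j = 0).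

End ArtCategory.

(* Only the action on objects and morphisms; the functor laws are the separate
   predicate [is_functor], which is part of [is_nat_trans]. *)
Record art_functor (K : fieldType) := ArtFunctor {
  fobj :> art K -> Type;
  fmap : forall A B : art K, art_hom A B -> fobj A -> fobj B
}.

Section Functors.
Context {K : fieldType}.
Implicit Types F G : art_functor K.

Definition is_functor F : Prop :=
  (forall (A : art K) (x : F A), fmap (art_id A) x = x) /\
  (forall (A B C : art K) (g : art_hom B C) (f : art_hom A B) (x : F A),
     fmap (art_comp g f) x = fmap g (fmap f x)).

Definition is_nat_trans F G (eta : forall A, F A -> G A) : Prop :=
  [/\ is_functor F, is_functor G &
      forall (A B : art K) (f : art_hom A B) (x : F A),
        eta B (fmap f x) = fmap f (eta A x)].

Definition one_point (T : Type) : Prop := exists x : T, forall y, y = x.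

Definition smooth F G (eta : forall A, F A -> G A) : Prop :=
  [/\ is_nat_trans eta, one_point (F art_field), one_point (G art_field) &
      forall (B A : art K) (p : art_hom B A), small_extension p ->
        forall (y : G B) (x : F A), fmap p y = eta A x ->
        exists2 z : F B, eta B z = y & fmap p z = x].

Definition nat_iso F G (eta : forall A, F A -> G A) : Prop :=
  is_nat_trans eta /\ forall A, bijective (eta A).

End Functors.

Section Deformations.
Context {K : fieldType}.

Section Object.
Variables (L : dgla K) (A : art K).

Notation LA := (tens L A).

Definition tdiff : LA -> LA := tens_map diff idfun.

Definition tbracket (x y : LA) : LA :=
  tens_lift (fun u a => tens_lift (fun v b => pure (bracket u v) (a * b)) y) x.

(* [tpart i] is L^i (x) m_A. *)
Definition tpart (i : int) : set LA := subtens (degree i) (@maxid K A).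

Definition MC : set LA :=
  [set x | tpart 1 x /\ tdiff x + (2%:R^-1 : K) *: tbracket x x = 0].

(* The sum has finite support on L^0 (x) m_A because m_A is nilpotent. *)
Definition gauge (a x : LA) : LA :=
  x + \sum_(n \in [set: nat])
        ((n.+1)`!%:R^-1 : K) *: iter n (tbracket a) (tbracket a x - tdiff a).

(* The quotient set of the gauge action is the set of its orbits.  As a set,
   exp(L^0 (x) m_A) is L^0 (x) m_A, so the group law plays no role here. *)
Definition gauge_orbit (x : LA) : set LA :=
  [set y | exists2 a, tpart 0 a & y = gauge a x].

Definition is_gauge_class (S : set LA) : Prop :=
  exists2 x, MC x & S = gauge_orbit x.

Definition Def_obj : Type := {S : set LA | is_gauge_class S}.

Definition Def_class (x : LA) (hx : MC x) : Def_obj :=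
  exist _ (gauge_orbit x) (ex_intro2 _ _ x hx erefl).

Definition Def_repr (c : Def_obj) : LA := s2val (cid2 (svalP c)).

Lemma Def_repr_MC (c : Def_obj) : MC (Def_repr c).
Proof. exact: s2valP. Qed.

Lemma Def_obj_inj (c d : Def_obj) : sval c = sval d -> c = d.
Proof.
case: c d => [S hS] [S' hS'] /= e; case: S' / e hS' => hS'.
by rewrite (Prop_irrelevance hS hS').
Qed.

Lemma Def_reprK (c : Def_obj) : Def_class (Def_repr_MC c) = c.
Proof. exact/Def_obj_inj/esym/(s2valP' (cid2 (svalP c))). Qed.

End Object.

Section Bracket.
Variables (L : dgla K) (A : art K).

Let br (u : L) (a : A) (v : L) (b : A) := pure (bracket u v) (a * b).

Let br_bilinear u a : bilinear_map (br u a).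
Proof.
have [p1 p2] := pure_bilinear L A; have [b1 _] := bracket_bilinear L.
split=> [v|b] c x z; rewrite /br; first by rewrite mulrDr -scalerAr p1.
by rewrite b1; exact: p2.
Qed.

Lemma tbracket_bilinear (y : tens L A) :
  bilinear_map (fun u a => tens_lift (br u a) y).
Proof.
have [p1 p2] := pure_bilinear L A; have [_ b2] := bracket_bilinear L.
have [s ->] := tens_spanned y.
have E u a : tens_lift (br u a) (\sum_(p <- s) pure p.1 p.2)
           = \sum_(p <- s) br u a p.1 p.2.
  by rewrite tens_lift_sum //; apply: eq_bigr => p _; rewrite tens_lift_pure.
split=> [u|a] c x z; rewrite !E scaler_sumr -big_split; apply: eq_bigr => p _ /=.
  by rewrite /br mulrDl -scalerAl p1.
by rewrite /br; have /= -> := b2 p.1 c x z; exact: p2.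
Qed.

Lemma tbracket_sum (I J : Type) (s : seq I) (t : seq J) (u : I -> L) (a : I -> A)
    (v : J -> L) (b : J -> A) :
  tbracket (\sum_(i <- s) pure (u i) (a i)) (\sum_(j <- t) pure (v j) (b j))
  = \sum_(i <- s) \sum_(j <- t) pure (bracket (u i) (v j)) (a i * b j).
Proof.
rewrite /tbracket tens_lift_sum; last exact: tbracket_bilinear.
apply: eq_bigr => i _; rewrite tens_lift_pure; last exact: tbracket_bilinear.
rewrite tens_lift_sum; last exact: br_bilinear.
by apply: eq_bigr => j _; rewrite tens_lift_pure //; exact: br_bilinear.
Qed.

End Bracket.

Section TensMap.
Variables (U V U' V' : lmodType K).
Variables (f : {linear U -> U'}) (g : {linear V -> V'}).

Lemma tens_map_bilinear : bilinear_map (fun u v => pure (f u) (g v)).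
Proof.
have [h1 h2] := pure_bilinear U' V'.
by split=> [u|a] c x y; rewrite linearP ?h1 //; exact: h2.
Qed.

Lemma tens_map_linear : linear (tens_map f g).
Proof. exact: tens_lift_linear tens_map_bilinear. Qed.

Lemma tens_map_sum (I : Type) (s : seq I) (u : I -> U) (v : I -> V) :
  tens_map f g (\sum_(i <- s) pure (u i) (v i))
  = \sum_(i <- s) pure (f (u i)) (g (v i)).
Proof.
rewrite /tens_map tens_lift_sum; last exact: tens_map_bilinear.
apply: eq_bigr => i _.
by rewrite tens_lift_pure //; exact: tens_map_bilinear.
Qed.

End TensMap.

Section MCMap.
Variables (L N : dgla K) (A B : art K) (phi : dgla_hom L N) (f : art_hom A B).

Let T : tens L A -> tens N B := tens_map phi f.

Lemma tens_map_tdiff x : T (tdiff x) = tdiff (T x).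
Proof.
have [s ->] := tens_spanned x; rewrite /T /tdiff !tens_map_sum.
by apply: eq_bigr => p _; rewrite dgla_fun_diff.
Qed.

Lemma tens_map_tbracket x y : T (tbracket x y) = tbracket (T x) (T y).
Proof.
have [s ->] := tens_spanned x; have [t ->] := tens_spanned y.
rewrite /T !tens_map_sum !tbracket_sum /tens_map tens_lift_sum;
  last exact: tens_map_bilinear.
apply: eq_bigr => p _; rewrite [LHS]tens_map_sum; apply: eq_bigr => q _.
by rewrite dgla_fun_bracket rmorphM.
Qed.

Lemma tens_map_tpart i x : tpart i x -> tpart i (T x).
Proof.
move=> [s hs ->]; exists [seq (phi p.1, f p.2) | p <- s]; last first.
  by rewrite /T tens_map_sum big_map.
move=> _ /mapP[p /hs[h1 h2] ->] /=.
by split; [exact: dgla_fun_degree | exact: art_fun_local].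
Qed.

Lemma tens_map_MC x : MC x -> MC (T x).
Proof.
move=> [hx e]; split; first exact: tens_map_tpart.
rewrite -tens_map_tdiff -tens_map_tbracket addrC -[T (tdiff x)]/(tens_map _ _ _).
by rewrite -tens_map_linear addrC e -(subrr 0) -scaleN1r addrC tens_map_linear
           scaleN1r addNr.
Qed.

(* Defined on the chosen representative of the orbit; the result is independent
   of it because gauge orbits are the classes of an equivalence relation
   (Baker-Campbell-Hausdorff), a fact that is not proved here. *)
Definition Def_map (c : Def_obj L A) : Def_obj N B :=
  Def_class (tens_map_MC (Def_repr_MC c)).

End MCMap.

Definition Def (L : dgla K) : art_functor K :=
  ArtFunctor (fun (A B : art K) (f : art_hom A B) => Def_map (dgla_id L) f).

Definition Def_mor (L N : dgla K) (phi : dgla_hom L N) (A : art K) :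
    Def L A -> Def N A :=
  Def_map phi (art_id A).

End Deformations.

(* Main.v *)
Require Import Defs.
From HB Require Import structures.
From mathcomp Require Import all_boot all_order all_algebra.
From mathcomp Require Import generic_quotient.
From mathcomp Require Import boolp classical_sets fsbigop.
From mathcomp Require Import zify.

(** The argument is obstruction theory along the powers of the maximal ideal [m].

    Write [q x = d x + 1/2 [x, x]] for the curvature of [x].  If [Q' <= Q <= m] are
    ideals with [m Q <= Q'], then for [x] of degree 1 with coefficients in [m] and [u]
    of degree 1 with coefficients in [Q] one has [q (x + u) = q x + d u] and, for [b]
    of degree 0 with coefficients in [Q], [exp b (x) = x - d b], both modulo [Q'].
    Hence the failure of an approximate
    solution modulo [Q'] is a cocycle with coefficients in [Q / Q'], and since the
    tensor product over a field is exact, the hypotheses on [H^i(phi)] apply to such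
    cocycles ([kuenneth_surj], [kuenneth_inj]).  This yields two correction steps:

    - [approximation_step] (H^1 onto, H^2 injective) improves an [x] over [L] whose
      image approximates, up to gauge, a given Maurer-Cartan element over [N];
    - [injectivity_step] (H^0 onto, H^1 injective) improves a gauge equivalence
      between two Maurer-Cartan elements over [L] whose images are equivalent.  The
      exact part of the degree 0 cocycle is absorbed by the stabiliser of the
      Maurer-Cartan element ([gauge_stabiliser]).

    For a small extension with kernel [J], the first step with [Q = J] and [Q' = 0]
    is smoothness.  Over a fixed algebra, iterating the steps with [Q = m^n] and
    [Q' = m^(n+1)] gives surjectivity and injectivity of [Def_phi], because [m] is
    nilpotent ([maxid_nilpotent]).

    Functoriality of [Def], and the freedom to change representatives, require the
    gauge orbits to be the classes of an equivalence relation.  The gauge action of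
    [a] is the exponential of a nilpotent linear operator [rho a] on the sum of
    [L (x) A] and a line, and [rho] is a Lie algebra representation in degree 0; so
    the point is that a product of two exponentials of elements of a nilpotent Lie
    algebra of operators is again such an exponential
    ([baker_campbell_hausdorff]).  It is proved by writing
    [exp (t x) exp (t y) = exp Z] with [Z] polynomial in [t], and reading off from
    the logarithmic derivative of both sides, by induction on the degree, that every
    coefficient of [Z] lies in the Lie algebra.  The same statement controls the
    exponent of a product modulo commutators, as [injectivity_step] demands. *)

Set Implicit Arguments.
Unset Strict Implicit.
Unset Printing Implicit Defensive.

Import GRing.Theory.
Local Open Scope ring_scope.
Local Open Scope classical_set_scope.

(** * Maximal submodules and linear functionals *)

Section Submodules.
Variables (R : pzRingType) (V : lmodType R).

(** Submodules as sets; for modules over a field these are the subspaces, and for a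
    ring acting on itself the ideals. *)
Definition submodule (P : set V) : Prop :=
  [/\ P 0, forall x y, P x -> P y -> P (x + y) & forall a x, P x -> P (a *: x)].

Lemma submoduleN (P : set V) x : submodule P -> P x -> P (- x).
Proof. by move=> [_ _ PZ] Px; rewrite -scaleN1r; exact: PZ. Qed.

Lemma submoduleB (P : set V) x y : submodule P -> P x -> P y -> P (x - y).
Proof. by move=> hP Px Py; case: (hP) => _ PD _; apply: PD => //; exact: submoduleN. Qed.

Lemma submodule_sum (P : set V) (I : Type) (r : seq I) (C : pred I) (F : I -> V) :
  submodule P -> (forall i, C i -> P (F i)) -> P (\sum_(i <- r | C i) F i).
Proof. by move=> [P0 PD _] PF; apply: big_ind. Qed.

(** Zorn's lemma: a submodule avoiding a vector extends to a maximal one. *)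
Lemma submodule_maximal (S : set V) (q : V) : submodule S -> ~ S q ->
  exists W : set V, [/\ submodule W, S `<=` W, ~ W q &
    forall W' : set V, submodule W' -> W `<=` W' -> ~ W' q -> W' = W].
Proof.
move=> hS Sq; have [S0 SD SZ] := hS.
(* The empty set satisfies this condition, as the empty chain requires. *)
pose P (W : set V) := [/\ forall x y, W x -> W y -> W (x + y),
  forall a x, W x -> W (a *: x), forall w s, W w -> S s -> W (w + s) & ~ W q].
have PP (W : set V) : submodule W -> S `<=` W -> ~ W q -> P W.
  by move=> [W0 WD WZ] SW Wq; split=> // w s Ww /SW; exact: WD.
have [|W [[WD WZ WS Wq] Wmax]] := @Zorn_bigcup V P.
  move=> F FP Ft; split.
  - move=> x y [A FA Ax] [B FB By].
    have [AB|BA] := Ft _ _ FA FB.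
      by exists B => //; have [h _ _ _] := FP _ FB; apply: h => //; exact: AB.
    by exists A => //; have [h _ _ _] := FP _ FA; apply: h => //; exact: BA.
  - move=> a x [A FA Ax]; exists A => //.
    by have [_ h _ _] := FP _ FA; exact: h.
  - move=> w s [A FA Aw] Ss; exists A => //.
    by have [_ _ h _] := FP _ FA; exact: h.
  - by move=> [A FA Aq]; have [_ _ _ h] := FP _ FA; exact: h.
have eqW W' : submodule W' -> S `<=` W' -> W `<=` W' -> ~ W' q -> W' = W.
  move=> hW' SW' WW' W'q; apply/seteqP; split=> //; apply: contrapT => nW.
  by apply: (Wmax W'); [split | exact: PP].
have [w Ww] : exists w, W w.
  apply: contrapT => nW; have e : S = W.
    by apply: eqW => // w Ww; case: nW; exists w.
  by case: nW; exists 0; rewrite -e.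
have W0 : W 0 by rewrite -(scale0r w); exact: WZ.
have SW : S `<=` W by move=> s Ss; rewrite -[s]add0r; exact: WS.
exists W; split=> // W' hW' WW' W'q; apply: eqW => //.
exact: subset_trans SW WW'.
Qed.

End Submodules.

(** Over a field, a subspace and a vector outside of it are separated by a
    linear functional: take it to vanish on a maximal subspace that contains
    the given one and avoids the vector. *)
Lemma separating_functional (K : fieldType) (V : lmodType K) (S : set V) (q : V) :
  submodule S -> ~ S q ->
  exists l : {linear V -> K^o}, (forall s, S s -> l s = 0) /\ l q = 1.
Proof.
move=> hS Sq; have [W [hW SW Wq Wmax]] := submodule_maximal hS Sq.
have [W0 WD WZ] := hW.
have ex v : exists c : K, W (v - c *: q).
  have [Wv|Wv] := pselect (W v); first by exists 0; rewrite scale0r subr0.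
  pose W' := [set w | exists c : K, W (w - c *: v)].
  have hW' : submodule W'.
    split; first by exists 0; rewrite scale0r subr0.
    - move=> x y [c Wc] [d Wd]; exists (c + d).
      by rewrite scalerDl opprD addrACA; exact: WD.
    - by move=> a x [c Wc]; exists (a * c); rewrite -scalerA -scalerBr; exact: WZ.
  have [c Wc] : W' q.
    apply: contrapT => W'q; apply: Wv.
    rewrite -(Wmax W' hW' _ W'q); last first.
      by move=> w Ww; exists 0; rewrite scale0r subr0.
    by exists 1; rewrite scale1r subrr.
  have c0 : c != 0 by apply/eqP => c0; apply: Wq; move: Wc; rewrite c0 scale0r subr0.
  exists c^-1; have := WZ (- c^-1) _ Wc.
  by rewrite scaleNr scalerBr opprB scalerA mulVf // scale1r.
have uniq_c v c d : W (v - c *: q) -> W (v - d *: q) -> c = d.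
  move=> Wc Wd; apply/eqP; rewrite -subr_eq0; apply/negPn/negP => cd.
  apply: Wq; rewrite -[q]scale1r -(mulVf cd) -scalerA; apply: WZ.
  have := submoduleB hW Wd Wc; rewrite opprB addrC addrA subrK.
  by rewrite scalerBl.
pose l (v : V) : K^o := sval (cid (ex v)); have lP v : W (v - l v *: q) by rewrite /l; case: cid.
have lin : linear l.
  move=> a x y; apply: (uniq_c (a *: x + y)) => //.
  rewrite -[(_ + _ : K^o)]/(a * l x + l y) scalerDl opprD addrACA -scalerA -scalerBr.
  by apply: WD => //; exact: WZ.
pose L : {linear V -> K^o} := HB.pack l (GRing.isLinear.Build K V K^o *:%R l lin).
exists L; split=> [s Ss|].
- by apply: (uniq_c s); [exact: lP|rewrite scale0r subr0; exact: SW].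
- by apply: (uniq_c q); [exact: lP|rewrite scale1r subrr].
Qed.

(** * The maximal ideal of an Artinian local algebra *)

Section LocalArtinian.
Variables (K : fieldType) (A : art K).
Local Notation m := (@maxid K A).

Lemma ideal_submodule (I : set A) :
  is_ideal I <-> submodule (I : set A^o).
Proof. by split=> -[]. Qed.

Lemma maxid_ideal : is_ideal m.
Proof. by case: (maxid_maximal A). Qed.

Lemma maxid1 : ~ m 1.
Proof. by case: (maxid_maximal A). Qed.

Lemma ideal_sub (I : set A) : is_ideal I -> is_subspace I.
Proof.
move=> [I0 ID IM]; split=> // a u v Iu Iv; apply: ID => //.
by rewrite -[u]mul1r scalerAl; exact: IM.
Qed.

Lemma maxid_scalar (c : K) : m c%:A -> c = 0.
Proof.
move=> mc; apply/eqP/negPn/negP => c0; apply: maxid1.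
have [_ mZ] := ideal_sub maxid_ideal; have [m0 _ _] := maxid_ideal.
by have := mZ c^-1 _ _ mc m0; rewrite addr0 scalerA mulVf // scale1r.
Qed.

Lemma proper_ideal_maxid (I : set A) : is_ideal I -> ~ I 1 -> I `<=` m.
Proof.
move=> hI I1.
have [W [hW IW W1 Wmax]] := submodule_maximal ((ideal_submodule I).1 hI) I1.
by rewrite -(@maxid_unique K A W).
Qed.

Lemma principal_ideal (x : A) : is_ideal [set x * a | a in [set: A]].
Proof.
split.
- by exists 0; rewrite ?mulr0.
- by move=> _ _ [a _ <-] [b _ <-]; exists (a + b); rewrite ?mulrDr.
- by move=> b _ [a _ <-]; exists (b * a); rewrite // mulrCA.
Qed.

(** If [y] is in the maximal ideal then [1 - y] is a unit; only this
    consequence is needed. *)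
Lemma maxid_fix_eq0 (x y : A) : m y -> x = x * y -> x = 0.
Proof.
move=> my xy; set I := [set (1 - y) * a | a in [set: A]].
have hI : is_ideal I := principal_ideal _.
have [[a _ e]|I1] := pselect (I 1).
  by rewrite -[x]mulr1 -e mulrA mulrBr mulr1 -xy subrr mul0r.
case: maxid1; have [_ mD _] := maxid_ideal.
rewrite -(subrK y 1); apply: mD => //; apply: (proper_ideal_maxid hI I1).
by exists 1; rewrite ?mulr1.
Qed.

(** [idealM I J] is the product of two ideals. *)
Definition idealM (I J : set A) : set A :=
  [set x | exists2 s : seq (A * A), (forall p, p \in s -> I p.1 /\ J p.2)
                                  & x = \sum_(p <- s) p.1 * p.2].

Lemma idealM_ideal (I J : set A) : is_ideal I -> is_ideal J -> is_ideal (idealM I J).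
Proof.
move=> [I0 ID IM] hJ; split.
- by exists [::]; rewrite ?big_nil.
- move=> _ _ [s hs ->] [t ht ->]; exists (s ++ t); rewrite ?big_cat //.
  by move=> p; rewrite mem_cat => /orP[/hs|/ht].
- move=> a _ [s hs ->]; exists [seq (a * p.1, p.2) | p <- s].
    by move=> _ /mapP[p /hs[p1 p2] ->] /=; split=> //; exact: IM.
  by rewrite big_map mulr_sumr; apply: eq_bigr => p _; rewrite mulrA.
Qed.

Lemma idealM_mul (I J : set A) x y : I x -> J y -> idealM I J (x * y).
Proof.
move=> Ix Jy; exists [:: (x, y)]; last by rewrite big_seq1.
by move=> p; rewrite inE => /eqP ->.
Qed.

(** [mpow n] is the n-th power of the maximal ideal. *)
Fixpoint mpow (n : nat) : set A :=
  if n is n'.+1 then idealM m (mpow n') else [set: A].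

Lemma mpow_ideal n : is_ideal (mpow n).
Proof. by elim: n => [|n ih] //=; apply: idealM_ideal => //; exact: maxid_ideal. Qed.

Lemma idealM_subr (I J : set A) : is_ideal J -> idealM I J `<=` J.
Proof.
move=> [J0 JD JM] _ [s hs ->]; elim: s hs => [|p s ih] hs; first by rewrite big_nil.
rewrite big_cons; apply: JD; last first.
  by apply: ih => q qs; apply: hs; rewrite inE qs orbT.
by apply: JM; have [] := hs p (mem_head _ _).
Qed.

Lemma mpowS n : mpow n.+1 `<=` mpow n.
Proof. by apply: idealM_subr; exact: mpow_ideal. Qed.

Lemma mpow_anti n k : (n <= k)%N -> mpow k `<=` mpow n.
Proof.
elim: k => [|k ih]; first by rewrite leqn0 => /eqP ->.
rewrite leq_eqVlt => /orP[/eqP -> //|nk].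
exact: subset_trans (@mpowS k) (ih nk).
Qed.

Lemma mpow1 : mpow 1 = m.
Proof.
apply/seteqP; split=> x.
  move=> [s hs ->]; have [m0 mD mM] := maxid_ideal.
  elim: s hs => [|p s ih] hs; first by rewrite big_nil.
  rewrite big_cons; apply: mD; last first.
    by apply: ih => q qs; apply: hs; rewrite inE qs orbT.
  by rewrite mulrC; apply: mM; have [] := hs p (mem_head _ _).
by move=> mx; rewrite -[x]mulr1; exact: idealM_mul.
Qed.

Lemma mpow_maxid n : mpow n.+1 `<=` m.
Proof. by rewrite -mpow1; exact: mpow_anti. Qed.

(** The descending chain condition provides an ideal that is minimal among those
    satisfying a given property. *)
Lemma artinian_minimal (P : set A -> Prop) (I0 : set A) :
  is_ideal I0 -> P I0 ->
  exists J, [/\ is_ideal J, P J &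
    forall J', is_ideal J' -> P J' -> J' `<=` J -> J' = J].
Proof.
move=> hI0 PI0; apply: contrapT => nomin.
have next (J : {I : set A | is_ideal I /\ P I}) :
    {J' : {I : set A | is_ideal I /\ P I} | sval J' `<=` sval J /\ sval J' <> sval J}.
  case: J => J [hJ PJ]; apply: cid; apply: contrapT => nJ; apply: nomin.
  exists J; split=> // J' hJ' PJ' J'J; apply: contrapT => ne; apply: nJ.
  by exists (exist _ J' (conj hJ' PJ')).
pose chain n := iter n (fun J => sval (next J)) (exist _ I0 (conj hI0 PI0)).
have [||n hn] := @art_artinian K A (fun n => sval (chain n)).
- by move=> n; case: (chain n) => J [].
- by move=> n; rewrite /chain /=; case: (next _) => J' [].
have := hn n.+1 (leqnSn n); rewrite /chain /=.
by case: (next _) => J' [].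
Qed.

(** The powers of [m] stabilise at some [I] with [m I = I].  If [I] were nonzero, an
    ideal [J] minimal with [J I <> 0] would contain some [x] with [x I <> 0] and
    [x m = J], so that [x = x a] with [a] in [m], and [x = 0]. *)
Lemma maxid_nilpotent : exists N, forall n, (N <= n)%N -> mpow n = [set 0].
Proof.
have [N hN] := art_artinian mpow_ideal mpowS.
suff h : mpow N = [set 0] by exists N => n /hN ->.
have hI := mpow_ideal N; set I := mpow N in hI *.
have mI : idealM m I = I by rewrite -[idealM m I]/(mpow N.+1) hN.
apply: contrapT => In0.
pose P J := exists x y, [/\ J x, I y & x * y <> 0].
have [||J [hJ [x [y [Jx Iy xy]]] Jmin]] := @artinian_minimal P [set: A].
- by [].
- apply: contrapT => nP; apply: In0; apply/seteqP; split=> y.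
    move=> Iy; apply: contrapT => y0; apply: nP; exists 1, y; split=> //.
    by rewrite mul1r.
  by move=> ->; case: hI.
have [J0 JD JM] := hJ.
have xJ : [set x * a | a in m] = J.
  have sub : [set x * a | a in m] `<=` J.
    by move=> _ [a _ <-]; rewrite mulrC; exact: JM.
  have [m0 mD mM] := maxid_ideal.
  apply: Jmin => //.
    split; first by exists 0; rewrite ?mulr0.
    - by move=> _ _ [a ma <-] [b mb <-]; exists (a + b); rewrite ?mulrDr //; exact: mD.
    - by move=> b _ [a ma <-]; exists (b * a); rewrite 1?mulrCA //; exact: mM.
  (* Otherwise x would annihilate m I = I. *)
  apply: contrapT => nP; apply: xy; move: Iy; rewrite -mI => -[s hs ->].
  rewrite mulr_sumr big_seq; apply: big1 => p /hs[mp Ip].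
  apply: contrapT => xp; apply: nP; exists (x * p.1), p.2.
  by split=> //; [exists p.1|rewrite -mulrA].
move: Jx; rewrite -xJ => -[a ma /esym /(maxid_fix_eq0 ma) x0].
by apply: xy; rewrite x0 mul0r.
Qed.

End LocalArtinian.

(** * Exponentials in a filtered ring *)

(** Reindexing of a truncated double sum by the total degree. *)
Lemma sum_triangle (V : zmodType) (N : nat) (h : nat -> nat -> V) :
  (forall i j, (N <= i + j)%N -> h i j = 0) ->
  \sum_(i < N) \sum_(j < N) h i j = \sum_(n < N) \sum_(i < n.+1) h i (n - i)%N.
Proof.
move=> h0.
under [RHS]eq_bigr => n _ do rewrite (big_ord_widen N (fun i => h i (n - i)%N)) //.
rewrite [RHS](exchange_big_dep xpredT) //=; apply: eq_bigr => i _.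
transitivity (\sum_(0 <= j < N - i) h i j).
  rewrite big_mkord (big_ord_widen N) ?leq_subr // [RHS]big_mkcond /=.
  by apply: eq_bigr => j _; case: ltnP => // ij; apply: h0; rewrite -leq_subLR.
transitivity (\sum_(i <= n < N) h i (n - i)%N).
  have /= := big_addn 0 N i xpredT (fun n => h i (n - i)%N); rewrite add0n => ->.
  by apply: eq_bigr => j _; rewrite addnK.
by rewrite (big_nat_widenl _ 0) // big_mkord; apply: eq_bigl => n; rewrite ltnS.
Qed.

Section Exponential.
Variables (K : fieldType) (R : nzRingType).

(** Scalars act on [R] through a central ring morphism [c], so that the theory
    applies to polynomial rings over an algebra as well. *)
Variables (c : {rmorphism K -> R}).
Hypothesis cC : forall k x, c k * x = x * c k.
Hypothesis charK : [pchar K] =i pred0.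

(** A multiplicative filtration of [R] whose [N]-th step vanishes. *)
Record filtration (I : nat -> set R) (N : nat) : Prop := Filtration {
  filt0 : forall n, I n 0;
  filtD : forall n x y, I n x -> I n y -> I n (x + y);
  filtM : forall i j x y, I i x -> I j y -> I (i + j)%N (x * y);
  filtT : forall x, I 0%N x;
  filtS : forall n x, I n.+1 x -> I n x;
  filt_nil : forall x, I N x -> x = 0 }.

(** The coefficients and the truncation of the exponential series. *)
Definition exp_coef (n : nat) : K := (n`!)%:R^-1.

Definition rexp (N : nat) (z : R) : R := \sum_(i < N) c (exp_coef i) * z ^+ i.

(** The commutator [x z - z x], seen as a function of [x]; with this sign the
    formulas below have no alternating signs. *)
Definition rcomm (z x : R) : R := x * z - z * x.

Lemma natr_neq0 n : (n.+1%:R : K) != 0.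
Proof. by rewrite (pcharf0P K).1. Qed.

Lemma exp_coef0 : exp_coef 0 = 1.
Proof. by rewrite /exp_coef fact0 invr1. Qed.

Lemma exp_coef1 : exp_coef 1 = 1.
Proof. by rewrite /exp_coef factS fact0 invr1. Qed.

Lemma exp_coef_bin n m : (m <= n)%N ->
  exp_coef n * 'C(n, m)%:R = exp_coef (n - m) * exp_coef m.
Proof.
move=> mn; rewrite /exp_coef -(bin_fact mn).
have f0 k : (k`!%:R : K) != 0 by rewrite (pcharf0P K).1 // -lt0n fact_gt0.
have b0 : ('C(n, m)%:R : K) != 0 by rewrite (pcharf0P K).1 // -lt0n bin_gt0.
by rewrite !natrM !invfM mulrAC mulVf // mul1r mulrC.
Qed.

Lemma mul_rcomm z x : x * z = z * x + rcomm z x.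
Proof. by rewrite /rcomm addrC subrK. Qed.

(** The formula behind [x exp z = exp z (exp (- ad z) x)], free of denominators. *)
Lemma mulXn_rcomm z x n :
  x * z ^+ n = \sum_(m < n.+1) (z ^+ (n - m) * iter m (rcomm z) x) *+ 'C(n, m).
Proof.
elim: n => [|n ih]; first by rewrite big_ord1 mulr1 mul1r.
rewrite exprSr mulrA ih mulr_suml.
under eq_bigr do rewrite mulrnAl -mulrA (mul_rcomm z) mulrDr mulrA -exprSr mulrnDl -iterS.
rewrite big_split /= [RHS]big_ord_recl [X in X + _]big_ord_recl /= !subn0 !bin0 -addrA.
congr (_ + _); rewrite [in RHS]big_ord_recr /= binn [X in _ + X]big_ord_recr /= binn.
rewrite addrA subnn !subSS subnn; congr (_ + _).
rewrite -big_split; apply: eq_bigr => i _ /=.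
by rewrite /bump /= !add1n binS mulrnDr subSS subnSK // addrC.
Qed.

(** The formula behind the derivative of the exponential, free of denominators. *)
Lemma derivation_exp_rcomm (D : R -> R) z n :
  (forall x y, D (x * y) = D x * y + x * D y) ->
  D (z ^+ n.+1) = \sum_(m < n.+1) (z ^+ (n - m) * iter m (rcomm z) (D z)) *+ 'C(n.+1, m.+1).
Proof.
move=> DM; elim: n => [|n ih]; first by rewrite big_ord1 mul1r.
rewrite exprSr DM ih mulr_suml.
under eq_bigr do rewrite mulrnAl -mulrA (mul_rcomm z) mulrDr mulrA -exprSr mulrnDl -iterS.
rewrite big_split /=; under [RHS]eq_bigr do rewrite binS mulrnDr.
rewrite big_split /= [X in _ = X + _]big_ord_recr /= bin_small // mulr0n addr0.
rewrite [X in _ = _ + X]big_ord_recl /= bin0 mulr1n subn0 -addrA; congr (_ + _).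
  by apply: eq_bigr => i _; rewrite subSn // -ltnS.
by rewrite addrC; congr (_ + _).
Qed.

Variables (I : nat -> set R) (N : nat).
Hypothesis HI : filtration I N.

Lemma filtZ n k x : I n x -> I n (c k * x).
Proof. by move=> Ix; rewrite -[n]add0n; apply: (filtM HI) => //; exact: filtT HI _. Qed.

Lemma filtN n x : I n x -> I n (- x).
Proof. by move=> Ix; rewrite -mulN1r -(rmorph1 c) -rmorphN; exact: filtZ. Qed.

Lemma filtB n x y : I n x -> I n y -> I n (x - y).
Proof. by move=> Ix Iy; apply: (filtD HI) => //; exact: filtN. Qed.

Lemma filt_anti i j x : (i <= j)%N -> I j x -> I i x.
Proof.
elim: j => [|j ih]; first by rewrite leqn0 => /eqP ->.
by rewrite leq_eqVlt => /orP[/eqP -> //|ij] /(filtS HI)/(ih ij).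
Qed.

Lemma filt_eq0 n x : (N <= n)%N -> I n x -> x = 0.
Proof. by move=> Nn /(filt_anti Nn)/(filt_nil HI). Qed.

Lemma filt_sum n (J : Type) (r : seq J) (P : pred J) (F : J -> R) :
  (forall j, P j -> I n (F j)) -> I n (\sum_(j <- r | P j) F j).
Proof. by move=> IF; apply: big_ind => //; [exact: filt0 HI n|exact: filtD HI n]. Qed.

Lemma filtX z i : I 1%N z -> I i (z ^+ i).
Proof.
move=> Iz; elim: i => [|i ih]; first exact: filtT HI _.
by rewrite exprS -add1n; exact: filtM HI _ _ _ _ Iz ih.
Qed.

Lemma filt_rcomm n z x : I 1%N z -> I n x -> I n.+1 (rcomm z x).
Proof.
move=> Iz Ix; apply: filtB; first by rewrite -addn1; exact: filtM HI _ _ _ _ Ix Iz.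
by rewrite -add1n; exact: filtM HI _ _ _ _ Iz Ix.
Qed.

Lemma filt_iter_rcomm n z x m : I 1%N z -> I n x -> I (m + n)%N (iter m (rcomm z) x).
Proof. by move=> Iz Ix; elim: m => [//|m ih]; rewrite addSn; exact: filt_rcomm. Qed.

Lemma rexp_triangle z x (f : nat -> K) : I 1%N z ->
  rexp N z * (\sum_(m < N) c (f m) * iter m (rcomm z) x) =
  \sum_(n < N) \sum_(m < n.+1)
     c (exp_coef (n - m) * f m) * (z ^+ (n - m) * iter m (rcomm z) x).
Proof.
move=> Iz; rewrite mulr_sumr.
under eq_bigr do rewrite mulr_suml.
rewrite (sum_triangle (h := fun i j => c (exp_coef j) * z ^+ j * (c (f i) * iter i (rcomm z) x))).
  apply: eq_bigr => n _; apply: eq_bigr => m _.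
  by rewrite rmorphM !mulrA; congr (_ * _); rewrite -!mulrA -cC.
move=> i j Nij; apply: (filt_eq0 Nij); rewrite addnC; apply: (filtM HI).
  exact/filtZ/filtX.
by apply: filtZ; have := filt_iter_rcomm i Iz (filtT HI x); rewrite addn0.
Qed.

Lemma mul_rexp z x : I 1%N z ->
  x * rexp N z = rexp N z * \sum_(m < N) c (exp_coef m) * iter m (rcomm z) x.
Proof.
move=> Iz; rewrite rexp_triangle // mulr_sumr; apply: eq_bigr => n _.
rewrite mulrA -cC -mulrA mulXn_rcomm mulr_sumr; apply: eq_bigr => m _.
rewrite -exp_coef_bin; last by rewrite -ltnS.
by rewrite rmorphM rmorph_nat -mulrA mulr_natl.
Qed.

Lemma derivation_rexp (D : R -> R) z : I 1%N z -> {morph D : x y / x + y} ->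
  (forall x y, D (x * y) = D x * y + x * D y) -> (forall k, D (c k) = 0) ->
  D (rexp N z) = rexp N z * \sum_(m < N) c (exp_coef m.+1) * iter m (rcomm z) (D z).
Proof.
move=> Iz DD DM Dc; rewrite (rexp_triangle (D z) (fun m => exp_coef m.+1) Iz).
have -> : rexp N z = \sum_(i < N.+1) c (exp_coef i) * z ^+ i.
  by rewrite big_ord_recr /= (filt_eq0 (leqnn N) (filtX N Iz)) mulr0 addr0.
have D0 : D 0 = 0 by rewrite -[in LHS](rmorph0 c) Dc.
rewrite (big_morph D DD D0) big_ord_recl /= mulr1 Dc add0r.
apply: eq_bigr => n _.
rewrite DM Dc mul0r add0r derivation_exp_rcomm // mulr_sumr; apply: eq_bigr => m _.
rewrite -(@exp_coef_bin n.+1 m.+1) ?subSS ?ltn_ord //.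
by rewrite rmorphM rmorph_nat -mulrA mulr_natl.
Qed.

Lemma rexp_comm0 z x : (0 < N)%N -> rcomm z x = 0 ->
  \sum_(m < N) c (exp_coef m.+1) * iter m (rcomm z) x = x.
Proof.
case: N => // M _ zx; rewrite big_ord_recl /= exp_coef1 rmorph1 mul1r.
rewrite big1 ?addr0 // => i _.
suff /= -> : iter i.+1 (rcomm z) x = 0 by rewrite mulr0.
by elim: (nat_of_ord i) => [//|j /= ->]; rewrite /rcomm mul0r mulr0 subrr.
Qed.

Lemma filt_gt0 : (0 < N)%N.
Proof.
rewrite lt0n; apply/eqP => N0.
by have /eqP := filt_eq0 (leqnn N) (filtX N (filt0 HI 1)); rewrite N0 oner_eq0.
Qed.

Lemma rexp_sub1 z : I 1%N z -> I 1%N (rexp N z - 1).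
Proof.
move=> Iz; rewrite /rexp; case: N filt_gt0 => // M _.
rewrite big_ord_recl /= exp_coef0 rmorph1 mul1r addrC addrA addNr add0r.
by apply: filt_sum => i _; apply: filtZ; apply: (filt_anti _ (filtX i.+1 Iz)).
Qed.

(** An element congruent to 1 modulo the first step is left cancellable. *)
Lemma rexp_cancel u x y : I 1%N (u - 1) -> u * x = u * y -> x = y.
Proof.
move=> Iu /eqP; rewrite -subr_eq0 -mulrBr => /eqP e; apply/eqP; rewrite -subr_eq0.
have h : x - y = - ((u - 1) * (x - y)) by rewrite mulrBl e mul1r sub0r opprK.
apply/eqP/(filt_eq0 (leqnn N)); elim: N => [|n ih]; first exact: filtT HI _.
by rewrite h; apply: filtN; rewrite -add1n; exact: filtM HI _ _ _ _ Iu ih.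
Qed.

Lemma exp_perturb n z w i : I 1%N z -> I n.+1 w -> I (n + i.+1)%N ((z + w) ^+ i.+1 - z ^+ i.+1).
Proof.
move=> Iz Iw; elim: i => [|i ih]; first by rewrite !expr1 addrC addKr addn1.
have Izw : I 1%N (z + w) by apply: (filtD HI) => //; exact: (filt_anti _ Iw).
rewrite exprS mulrDl.
have -> : z * (z + w) ^+ i.+1 + w * (z + w) ^+ i.+1 - z ^+ i.+2 =
          z * ((z + w) ^+ i.+1 - z ^+ i.+1) + w * (z + w) ^+ i.+1.
  by rewrite mulrBr -exprS addrAC.
apply: (filtD HI).
  by rewrite addnS -add1n; exact: filtM HI _ _ _ _ Iz ih.
by rewrite -addSnnS; apply: filtM HI _ _ _ _ Iw _; exact: filtX.
Qed.

(** Logarithms exist; they are obtained by successive approximation. *)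
Lemma rexp_surj u : I 1%N (u - 1) -> exists2 z, I 1%N z & rexp N z = u.
Proof.
move=> Iu; suff [z Iz /(filt_anti (leqnSn N))] :
    exists2 z, I 1%N z & I N.+1 (rexp N z - u).
  by move=> /(filt_nil HI)/eqP; rewrite subr_eq0 => /eqP e; exists z.
elim: {1}N => [|n [z Iz Iw]].
  exists 0; first exact: filt0 HI _.
  rewrite -opprB; apply: filtN; rewrite -(subrK 1 u) -addrA; apply: (filtD HI) => //.
  by rewrite -opprB; apply: filtN; apply: rexp_sub1; exact: filt0 HI _.
exists (z - (rexp N z - u)).
  by apply: filtB => //; exact: (filt_anti _ Iw).
set w := rexp N z - u in Iw *.
have -> : rexp N (z - w) - u = rexp N (z - w) - rexp N z + w.
  by rewrite addrA subrK.
rewrite /rexp -sumrB; under eq_bigr do rewrite -mulrBr.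
case: N filt_gt0 (@filt_eq0 n.+1 w) => [//|M _ w0].
rewrite big_ord_recl /= !expr0 subrr mulr0 add0r; case: M w0 => [w0|M _].
  by rewrite big_ord0 add0r w0 //; exact: filt0 HI _.
rewrite big_ord_recl /= exp_coef1 rmorph1 mul1r !expr1 [z - w]addrC addrK addrAC addNr add0r.
apply: filt_sum => i _; apply: filtZ.
apply: (@filt_anti _ (n + (bump 0 (bump 0 i)))%N).
  by rewrite /bump /= !add1n !addnS !ltnS leq_addr.
by rewrite [- w + z]addrC; apply: exp_perturb => //; exact: filtN.
Qed.

End Exponential.

(** * The Baker-Campbell-Hausdorff theorem *)

Section PolyFiltration.
Variables (R : nzRingType) (I : nat -> set R) (N : nat).
Hypothesis HI : filtration I N.

(** The filtration induced on polynomials; its positive steps consist of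
    polynomials without constant term. *)
Definition pfilt (n : nat) : set {poly R} :=
  [set p | (forall k, I n p`_k) /\ ((0 < n)%N -> p`_0 = 0)].

Lemma pfiltration : filtration pfilt N.
Proof.
split.
- by move=> n; split=> [k|_]; rewrite coef0 //; exact: filt0 HI _.
- move=> n p q [Ip p0] [Iq q0]; split=> [k|n0]; rewrite coefD.
    by apply: (filtD HI).
  by rewrite p0 // q0 // addr0.
- move=> i j p q [Ip p0] [Iq q0]; split=> [k|]; rewrite coefM.
    by apply: big_ind => [||l _]; [exact: filt0 HI _|exact: filtD HI _|exact: filtM HI _ _ _ _ _ _].
  rewrite big_ord1 addn_gt0 => /orP[/p0|/q0] ->; by rewrite ?mul0r ?mulr0.
- by move=> p; split=> // k; exact: filtT HI _.
- move=> n p [Ip p0]; split=> [k|_]; last exact: p0.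
  exact: filtS HI _ _ _.
- move=> p [Ip _]; apply/polyP => k; rewrite coef0; exact: filt_nil HI _ _.
Qed.

End PolyFiltration.

Section BakerCampbellHausdorff.
Variables (K : fieldType) (R : nzRingType) (c : {rmorphism K -> R}).
Hypothesis cC : forall k x, c k * x = x * c k.
Hypothesis charK : [pchar K] =i pred0.
Variables (I : nat -> set R) (N : nat).
Hypothesis HI : filtration I N.

(** [g] is a Lie subalgebra of the first step of the filtration, and [h] a subspace
    containing its commutators. *)
Variables (g h : set R).
Hypotheses (g0 : g 0) (gD : forall x y, g x -> g y -> g (x + y))
  (gZ : forall k x, g x -> g (c k * x)) (gI : g `<=` I 1%N).
Hypotheses (h0 : h 0) (hD : forall x y, h x -> h y -> h (x + y))
  (hZ : forall k x, h x -> h (c k * x)) (hg : h `<=` g).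
Hypothesis gh : forall x y, g x -> g y -> h (x * y - y * x).

(* Naming the ring structure keeps the domain and codomain of [d] free of
   conversions that unification would not see through. *)
Local Notation P := (poly_polynomial__canonical__GRing_NzRing R).

Let d : {rmorphism K -> P} := (polyC \o c)%FUN.

Let dC k (p : {poly R}) : d k * p = p * d k.
Proof.
apply/polyP => i; rewrite /d /= coefCM coefMC; exact: cC.
Qed.

Let HP := pfiltration HI.

Let coefd k (p : {poly R}) i : (d k * p)`_i = c k * p`_i.
Proof. by rewrite /d /= coefCM. Qed.

Let h_sum (J : Type) (r : seq J) (P : pred J) (F : J -> R) :
  (forall j, P j -> h (F j)) -> h (\sum_(j <- r | P j) F j).
Proof. by move=> hF; apply: big_ind. Qed.

(** Coefficients of iterated commutators: if the coefficients of [Z] up to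
    degree [k] and those of [p] below degree [k] are in [g], then, as [Z] has no
    constant term, those of the commutator are in [h] up to degree [k]. *)
Let rcomm_coef (Z p : {poly R}) k : Z`_0 = 0 ->
  (forall j, (j <= k)%N -> g Z`_j) -> (forall j, (j < k)%N -> g p`_j) ->
  forall j, (j <= k)%N -> h (rcomm Z p)`_j.
Proof.
move=> Z0 gZ' gp j jk; rewrite /rcomm coefB coefM coefMr -sumrB.
apply: h_sum => i _; have [ij|ij] := ltnP i k.
  by apply: gh; [exact: gp|apply: gZ'; exact: leq_trans (leq_subr _ _) jk].
have -> : (j - i = 0)%N by apply/eqP; rewrite subn_eq0 (leq_trans jk).
by rewrite Z0 mulr0 mul0r subrr.
Qed.

Let iter_rcomm_coef (Z p : {poly R}) k m : Z`_0 = 0 ->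
  (forall j, (j <= k)%N -> g Z`_j) -> (forall j, (j < k)%N -> g p`_j) ->
  forall j, (j <= k)%N -> h (iter m.+1 (rcomm Z) p)`_j.
Proof.
move=> Z0 gZ' gp; elim: m => [|m ih]; first exact: rcomm_coef.
by rewrite iterS; apply: rcomm_coef => // j jk; apply/hg/ih/ltnW.
Qed.

Theorem baker_campbell_hausdorff x y : g x -> g y ->
  exists z, [/\ g z, h (z - (x + y)) & rexp c N x * rexp c N y = rexp c N z].
Proof.
move=> gx gy; pose tX := x%:P * 'X; pose tY := y%:P * 'X.
have N0 := filt_gt0 HI.
have tI u : g u -> pfilt I 1 (u%:P * 'X).
  move=> gu; split=> [k|_]; rewrite coefMX //; case: k => [|k] /=; first exact: filt0 HI _.
  by rewrite coefC; case: ifP => _; [exact: gI|exact: filt0 HI _].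
have tXI : pfilt I 1 tX := tI _ gx.
have tYI : pfilt I 1 tY := tI _ gy.
have Eu : pfilt I 1 (rexp d N tX * rexp d N tY - 1).
  have -> : rexp d N tX * rexp d N tY - 1 =
     (rexp d N tX - 1) * rexp d N tY + (rexp d N tY - 1).
    by rewrite mulrBl mul1r addrA subrK.
  have X1 := rexp_sub1 d HP tXI; have Y1 := rexp_sub1 d HP tYI.
  exact (filtD HP (filtM HP X1 (filtT HP _)) Y1).
have [Z IZ EZ] := rexp_surj d HP Eu.
have Z0 : Z`_0 = 0 by apply: IZ.2.
have Dd k : (d k)^`() = 0 by rewrite /d /= derivC.
have DM (p q : {poly R}) : (p * q)^`() = p^`() * q + p * q^`() := derivM p q.
have Dt u : (u%:P * 'X)^`() = u%:P by rewrite derivM derivC mul0r add0r derivX mulr1.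
have Dexp u : g u -> (rexp d N (u%:P * 'X))^`() = rexp d N (u%:P * 'X) * u%:P.
  move=> gu; rewrite (derivation_rexp dC charK HP (tI _ gu) (@derivD R) DM Dd) Dt rexp_comm0 //.
  by rewrite /rcomm -mulrA -['X * _]commr_polyX mulrA subrr.
(* The logarithmic derivative of exp(tx) exp(ty). *)
pose W := y%:P + \sum_(m < N) d (exp_coef K m) * iter m (rcomm tY) x%:P.
have DE : (rexp d N tX * rexp d N tY)^`() = rexp d N tX * rexp d N tY * W.
  rewrite derivM !Dexp // -[X in X + _]mulrA (mul_rexp dC charK HP x%:P tYI).
  rewrite /W mulrDr [RHS]addrC.
  by rewrite !mulrA.
have ZW : \sum_(m < N) d (exp_coef K m.+1) * iter m (rcomm Z) Z^`() = W.
  apply: (rexp_cancel d HP Eu); rewrite -DE -EZ.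
  by rewrite (derivation_rexp dC charK HP IZ (@derivD R) DM Dd).
have gtY j : g tY`_j.
  by rewrite /tY coefMX coefC; case: j => [|[|j]].
have gC u j : g u -> g u%:P`_j by rewrite coefC; case: ifP.
have hW j : h (W - (x + y)%:P)`_j.
  rewrite /W coefB coefD coefC coef_sum; case: N N0 => // M _.
  rewrite big_ord_recl coefd exp_coef0 rmorph1 mul1r /= !coefC.
  rewrite [X in h X](_ : _ = \sum_(i < M) (d (exp_coef K (bump 0 i)) * iter (bump 0 i) (rcomm tY) x%:P)`_j).
    apply: h_sum => i _; rewrite coefd; apply: hZ; apply: (@iter_rcomm_coef _ _ j) => //.
      by rewrite coefMX.
    by move=> l _; exact: gC.
  case: ifP => _; last by rewrite addrA !addr0 subr0 add0r.
  by rewrite addrA [y + x]addrC [LHS]addrC addKr.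
have step k : (forall j, (j <= k)%N -> g Z`_j) -> h (Z^`() - (x + y)%:P)`_k.
  move=> gZk; have -> : Z^`() - (x + y)%:P = W - (x + y)%:P -
      \sum_(m < N.-1) d (exp_coef K m.+2) * iter m.+1 (rcomm Z) Z^`().
    rewrite -ZW; case: N N0 => // M _; rewrite big_ord_recl /= exp_coef1 rmorph1 mul1r.
    by rewrite addrAC addrK.
  rewrite coefB; apply: hD => //; rewrite -[- _]mul1r -(rmorph1 c) mulrN -mulNr -rmorphN.
  apply: hZ; rewrite coef_sum; apply: h_sum => i _; rewrite coefd; apply: hZ.
  apply: (@iter_rcomm_coef _ _ k) => // j jk; rewrite coef_deriv -mulr_natl.
  by rewrite -(rmorph_nat c); apply: gZ; exact: gZk.
have hC j u : h u -> h u%:P`_j by rewrite coefC; case: ifP.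
have unit_coef k : Z`_k.+1 = c k.+1%:R^-1 * (Z^`())`_k.
  rewrite coef_deriv -[X in _ = _ * X]mulr_natl -(rmorph_nat c k.+1) mulrA -rmorphM.
  rewrite mulVf ?natr_neq0 //.
  by rewrite rmorph1 mul1r.
have gZc k : g Z`_k.
  elim/ltn_ind: k => -[|k] ih; first by rewrite Z0.
  have /hg := step k (fun j jk => ih j jk).
  rewrite unit_coef coefB => hk; apply: gZ.
  by rewrite -[X in g X](subrK ((x + y)%:P`_k)); apply: gD => //; apply/gC/gD.
have Z1 : h (Z`_1 - (x + y)).
  by have := step 0%N (fun j _ => gZc j); rewrite coefB coef_deriv mulr1n coefC.
have Z2 k : h Z`_k.+2.
  have := step k.+1 (fun j _ => gZc j); rewrite coefB coefC subr0 => hk.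
  by rewrite unit_coef; exact: hZ.
have evM (p q : {poly R}) : (p * q).[1] = p.[1] * q.[1].
  by apply: hornerM_comm; rewrite /comm_poly mul1r mulr1.
have evexp (p : {poly R}) : (rexp d N p).[1] = rexp c N p.[1].
  rewrite /rexp horner_sum; apply: eq_bigr => i _.
  rewrite evM /d /= hornerC; congr (_ * _).
  by elim: (nat_of_ord i) => [|j ih]; rewrite ?expr0 ?hornerC // !exprS evM ih.
have -> : rexp c N x * rexp c N y = rexp c N Z.[1].
  by rewrite -evexp EZ evM !evexp !evM !hornerC !hornerX !mulr1.
have eZ : Z.[1] - (x + y) = Z`_1 - (x + y) + \sum_(i < size Z) Z`_i.+2.
  rewrite (@horner_coef_wide _ (size Z).+2) ?leqW //.
  rewrite !big_ord_recl /= Z0 mul0r add0r expr1n mulr1 addrAC; congr (_ + _).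
  by apply: eq_bigr => i _; rewrite expr1n mulr1.
have hz : h (Z.[1] - (x + y)) by rewrite eZ; apply: hD => //; exact: h_sum.
exists Z.[1]; split=> //.
by rewrite -(subrK (x + y) Z.[1]); apply: gD; [exact: hg|exact: gD].
Qed.

End BakerCampbellHausdorff.

(** * Tensor products and cohomology *)

Section Tensors.
Variable K : fieldType.

Lemma pureZl (U V : lmodType K) k (u : U) (v : V) : pure (k *: u) v = k *: pure u v.
Proof.
have [_ h] := pure_bilinear U V; have /= := h v k u 0.
have -> : pure (0 : U) v = 0; last by rewrite !addr0.
by have /= := h v (-1) 0 0; rewrite !scaleN1r !addNr.
Qed.

Lemma pureZr (U V : lmodType K) k (u : U) (v : V) : pure u (k *: v) = k *: pure u v.
Proof.
have [h _] := pure_bilinear U V; have /= := h u k v 0.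
have -> : pure u (0 : V) = 0; last by rewrite !addr0.
by have /= := h u (-1) 0 0; rewrite !scaleN1r !addNr.
Qed.

Lemma pure0l (U V : lmodType K) (v : V) : pure (0 : U) v = 0.
Proof. by rewrite -(scale0r (0 : U)) pureZl scale0r. Qed.

Lemma pure0r (U V : lmodType K) (u : U) : pure u (0 : V) = 0.
Proof. by rewrite -(scale0r (0 : V)) pureZr scale0r. Qed.

Lemma pureDl (U V : lmodType K) (u u' : U) (v : V) : pure (u + u') v = pure u v + pure u' v.
Proof. by have [_ h] := pure_bilinear U V; have /= := h v 1 u u'; rewrite !scale1r. Qed.

Lemma pureDr (U V : lmodType K) (u : U) (v v' : V) : pure u (v + v') = pure u v + pure u v'.
Proof. by have [h _] := pure_bilinear U V; have /= := h u 1 v v'; rewrite !scale1r. Qed.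

Lemma pure_suml (U V : lmodType K) (I : Type) (r : seq I) (F : I -> U) (v : V) :
  pure (\sum_(i <- r) F i) v = \sum_(i <- r) pure (F i) v.
Proof.
by elim: r => [|i r ih]; rewrite ?big_nil ?pure0l // !big_cons pureDl ih.
Qed.

Lemma pure_sumr (U V : lmodType K) (I : Type) (r : seq I) (u : U) (F : I -> V) :
  pure u (\sum_(i <- r) F i) = \sum_(i <- r) pure u (F i).
Proof.
by elim: r => [|i r ih]; rewrite ?big_nil ?pure0r // !big_cons pureDr ih.
Qed.

Section Subtens.
Variables (U V : lmodType K).
Implicit Types (P : set U) (Q : set V) (x y : tens U V).

Lemma subspace_submodule (W : lmodType K) (S : set W) : is_subspace S <-> submodule S.
Proof.
split=> [[S0 h]|[S0 SD SZ]].
  by split=> // [x y Sx Sy|a x Sx]; [rewrite -[x]scale1r|rewrite -[_ *: _]addr0]; exact: h.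
by split=> // a u v Su Sv; apply: SD => //; exact: SZ.
Qed.

Lemma subtens_submodule P Q : submodule P -> submodule (subtens P Q).
Proof.
move=> [P0 PD PZ]; split.
- by exists [::]; rewrite ?big_nil.
- move=> _ _ [s hs ->] [t ht ->]; exists (s ++ t); rewrite ?big_cat //.
  by move=> p; rewrite mem_cat => /orP[/hs|/ht].
- move=> a _ [s hs ->]; exists [seq (a *: p.1, p.2) | p <- s].
    by move=> _ /mapP[p /hs[p1 p2] ->] /=; split=> //; exact: PZ.
  by rewrite big_map scaler_sumr; apply: eq_bigr => p _; rewrite pureZl.
Qed.

Lemma subtens_pure P Q u v : P u -> Q v -> subtens P Q (pure u v).
Proof.
move=> Pu Qv; exists [:: (u, v)]; last by rewrite big_seq1.
by move=> p; rewrite inE => /eqP ->.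
Qed.

Lemma subtens_subset P P' Q Q' : P `<=` P' -> Q `<=` Q' -> subtens P Q `<=` subtens P' Q'.
Proof.
move=> PP' QQ' x [s hs ->]; exists s => // p /hs[Pp Qp].
by split; [exact: PP'|exact: QQ'].
Qed.

Lemma subtensT x : subtens setT setT x.
Proof. by have [s ->] := tens_spanned x; exists s. Qed.

(** Induction on a tensor in [subtens P Q]. *)
Lemma subtens_ind P Q (C : tens U V -> Prop) : C 0 ->
  (forall x y, C x -> C y -> C (x + y)) ->
  (forall u v, P u -> Q v -> C (pure u v)) -> forall x, subtens P Q x -> C x.
Proof.
move=> C0 CD Cp _ [s hs ->]; rewrite big_seq; apply: big_ind => // p /hs[Pp Qp].
exact: Cp.
Qed.

Lemma subtens_zero P x : subtens P [set 0] x -> x = 0.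
Proof.
apply: (@subtens_ind P [set 0] (fun x => x = 0)) => // [_ _ -> ->|u _ _ ->].
  by rewrite addr0.
by rewrite pure0r.
Qed.

End Subtens.

(** Contraction of the second tensor factor with a linear functional. *)
Definition contract (U V : lmodType K) (l : {linear V -> K^o}) : tens U V -> U :=
  tens_lift (fun u v => (l v : K) *: u).

Section Contraction.
Variables (U V : lmodType K) (l : {linear V -> K^o}).

Lemma contract_bilinear : bilinear_map (fun (u : U) (v : V) => (l v : K) *: u).
Proof.
split=> [u|v] a x y /=.
  by rewrite linearP scalerDl -scalerA.
by rewrite scalerDr !scalerA mulrC.
Qed.

Lemma contract_linear : linear (@contract U V l).
Proof. exact: tens_lift_linear contract_bilinear. Qed.

HB.instance Definition _ := GRing.isLinear.Build K (tens U V) U *:%R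
  (@contract U V l) contract_linear.

Lemma contractB x y : contract l (x - y : tens U V) = contract l x - contract l y.
Proof. exact: linearB. Qed.

Lemma contract_pure u v : contract l (pure u v : tens U V) = (l v : K) *: u.
Proof. by rewrite /contract tens_lift_pure //; exact: contract_bilinear. Qed.

Lemma contract_subtens (P : set U) (Q : set V) x : submodule P ->
  subtens P Q x -> P (contract l x).
Proof.
move=> hP; have [P0 PD PZ] := hP.
apply: (subtens_ind (C := fun x => P (contract l x))) => [|y z|u v Pu _].
- by rewrite linear0.
- by rewrite linearD; exact: PD.
- by rewrite contract_pure; exact: PZ.
Qed.

Lemma contract_eq0 (P : set U) (Q : set V) x :
  (forall v, Q v -> l v = 0) -> subtens P Q x -> contract l x = 0.
Proof.
move=> lQ; apply: (subtens_ind (C := fun x => contract l x = 0)) => [|y z y0 z0|u v _ /lQ v0].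
- by rewrite linear0.
- by rewrite linearD /= y0 z0 addr0.
- by rewrite contract_pure v0 scale0r.
Qed.

End Contraction.

Lemma tens_map_pure (U V U' V' : lmodType K) (f : {linear U -> U'})
    (g : {linear V -> V'}) u v : tens_map f g (pure u v) = pure (f u) (g v).
Proof. by rewrite /tens_map tens_lift_pure //; exact: tens_map_bilinear. Qed.

Lemma tens_ind (U V : lmodType K) (C : tens U V -> Prop) : C 0 ->
  (forall x y, C x -> C y -> C (x + y)) -> (forall u v, C (pure u v)) -> forall x, C x.
Proof. by move=> C0 CD Cp x; exact: (subtens_ind C0 CD (fun u v _ _ => Cp u v) (subtensT x)). Qed.

Section TensMapLinear.
Variables (U V U' V' : lmodType K) (f : {linear U -> U'}) (g : {linear V -> V'}).
HB.instance Definition _ := GRing.isLinear.Build K (tens U V) (tens U' V') *:%R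
  (tens_map f g) (tens_map_linear f g).
End TensMapLinear.

Lemma contract_map (U V U' V' : lmodType K) (f : {linear U -> U'})
    (g : {linear V -> V'}) (l : {linear V -> K^o}) (l' : {linear V' -> K^o}) x :
  (forall v, l' (g v) = l v) -> contract l' (tens_map f g x) = f (contract l x).
Proof.
move=> ll; elim/tens_ind: x => [|x y hx hy|u v]; first by rewrite !linear0.
  by rewrite !linearD /= hx hy.
by rewrite tens_map_pure !contract_pure ll linearZ.
Qed.

Lemma tens_map_subtens (U V U' V' : lmodType K) (f : {linear U -> U'})
    (g : {linear V -> V'}) (P : set U) (Q : set V) (P' : set U') (Q' : set V') x :
  submodule P' ->
  (forall u, P u -> P' (f u)) -> (forall v, Q v -> Q' (g v)) ->
  subtens P Q x -> subtens P' Q' (tens_map f g x).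
Proof.
move=> hP' fP gQ; have [S0 SD _] := @subtens_submodule _ _ P' Q' hP'.
apply: (subtens_ind (C := fun x => subtens P' Q' (tens_map f g x))) => [|y z|u v Pu Qv]; first by rewrite linear0.
  by rewrite linearD; exact: SD.
by rewrite tens_map_pure; apply: subtens_pure; [exact: fP|exact: gQ].
Qed.

(** Finitely many vectors of [Q] lie, modulo the subspace [Q'], in the image of a
    finite rank operator with values in [Q] that vanishes on [Q'] and fixes
    them modulo [Q']. *)
Lemma finite_rank_projection (V : lmodType K) (Q Q' : set V) (s : seq V) :
  submodule Q -> submodule Q' -> (forall v, v \in s -> Q v) ->
  exists n (l : nat -> {linear V -> K^o}) (q : nat -> V),
    [/\ forall i, Q (q i), forall i v, Q' v -> l i v = 0 &
        forall v, v \in s -> Q' (v - \sum_(i < n) (l i v : K) *: q i)].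
Proof.
move=> hQ hQ' sQ; have [Q0 QD QZ] := hQ; have [Q'0 Q'D Q'Z] := hQ'.
suff [n [l [q [Qq lQ' [sq qq]]]]] : exists n (l : nat -> {linear V -> K^o}) (q : nat -> V),
    [/\ forall i, Q (q i), forall i v, Q' v -> l i v = 0 &
        (forall v, v \in s -> Q' (v - \sum_(i < n) (l i v : K) *: q i)) /\
        (forall j, (j < n)%N -> Q' (q j - \sum_(i < n) (l i (q j) : K) *: q i))].
  by exists n, l, q.
elim: s sQ => [|w s ih] sQ; first by exists 0%N, (fun=> \0%R), (fun=> 0).
have [n [l [q [Qq lQ' [sq qq]]]]] : exists n (l : nat -> {linear V -> K^o}) (q : nat -> V), _
  := ih (fun v vs => sQ v (mem_behead (s := w :: s) vs)).
pose pi v := \sum_(i < n) (l i v : K) *: q i.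
have piD a x y : pi (a *: x + y) = a *: pi x + pi y.
  rewrite /pi scaler_sumr -big_split; apply: eq_bigr => i _ /=.
  by rewrite linearP scalerDl scalerA.
pose S := [set v | Q' (v - pi v)].
have hS : submodule S.
  have h a x y : S x -> S y -> S (a *: x + y).
    move=> Sx Sy; rewrite /S /= piD opprD addrACA -scalerBr.
    by apply: Q'D => //; exact: Q'Z.
  apply/subspace_submodule; split=> //; rewrite /S /= /pi big1 ?subr0 // => i _.
  by rewrite linear0 scale0r.
have [S0 SD SZ] := hS.
have Q'S v : Q' v -> S v.
  move=> Q'v; rewrite /S /= /pi big1 ?subr0 // => i _.
  by rewrite lQ' // scale0r.
have Spi v : S (pi v) by apply: submodule_sum => // i _; apply: SZ; exact: qq.
have [Sw|Sw] := pselect (S w).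
  exists n, l, q; split=> //; split=> // v; rewrite inE => /orP[/eqP -> //|].
  exact: sq.
pose w' := w - pi w.
have Sw' : ~ S w' by move=> Sw'; apply: Sw; rewrite -(subrK (pi w) w); exact: SD.
have Qw : Q w by apply: sQ; rewrite inE eqxx.
have Qw' : Q w' by apply: submoduleB => //; apply: submodule_sum => // i _; exact: QZ.
have [l0 [l0S l0w]] := separating_functional hS Sw'.
have pi' v : \sum_(i < n.+1) ((if i == n :> nat then l0 else l i) v : K) *:
    (if i == n :> nat then w' else q i) = pi v + (l0 v : K) *: w'.
  rewrite big_ord_recr /= eqxx; congr (_ + _); apply: eq_bigr => i _.
  by rewrite ltn_eqF.
have piS v : S v -> pi v + (l0 v : K) *: w' = pi v.
  by move=> /l0S ->; rewrite scale0r addr0.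
have piw' : pi w' + (l0 w' : K) *: w' = pi w' + w' by rewrite l0w scale1r.
have fixw' : Q' (w' - (pi w' + (l0 w' : K) *: w')).
  rewrite piw' opprD addrCA subrr addr0; apply: submoduleN => //.
  rewrite /w' -[pi _]/(pi (w - pi w)) -scaleN1r addrC piD scaleN1r addrC.
  exact: Spi.
have fixS v : S v -> Q' (v - (pi v + (l0 v : K) *: w')).
  by move=> Sv; rewrite piS.
exists n.+1, (fun i => if i == n then l0 else l i), (fun i => if i == n then w' else q i).
split=> [i|i v Q'v|]; [by case: ifP| |].
  by case: ifP => _; [apply: l0S; exact: Q'S|exact: lQ'].
split=> [v|j].
  rewrite pi' inE => /orP[/eqP ->|/sq]; last exact: fixS.
  have -> : w - (pi w + (l0 w : K) *: w') =
    (w' - (pi w' + (l0 w' : K) *: w')) + (pi w - (pi (pi w) + (l0 (pi w) : K) *: w')).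
    rewrite addrACA subrK -opprD; congr (_ - _).
    rewrite addrACA -scalerDl.
    have -> : pi w' + pi (pi w) = pi w.
      by rewrite -[pi w']scale1r -piD scale1r subrK.
    by congr (_ + _ *: _); rewrite -[LHS]/(l0 w) -{1}(subrK (pi w) w) linearD.
  by apply: Q'D => //; exact: fixS.
rewrite ltnS leq_eqVlt pi'; case: eqP => [_ _|_ /= jn]; first exact: fixw'.
by apply: fixS; exact: qq.
Qed.

(** The key device: modulo [subtens P Q'], a tensor in [subtens P Q] is a sum of
    pure tensors whose left factors are contractions of it with functionals
    vanishing on [Q'].  A linear condition on the tensor modulo [Q'] is thus
    inherited by these left factors. *)
Lemma tens_decomposition (U V : lmodType K) (P : set U) (Q Q' : set V) x :
  submodule P -> submodule Q -> submodule Q' -> subtens P Q x ->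
  exists n (l : nat -> {linear V -> K^o}) (q : nat -> V),
    [/\ forall i, Q (q i), forall i v, Q' v -> l i v = 0 &
        subtens P Q' (x - \sum_(i < n) pure (contract (l i) x) (q i))].
Proof.
move=> hP hQ hQ' [s sPQ ->].
have [|n [l [q [Qq lQ' sq]]]] := @finite_rank_projection V Q Q' (map snd s) hQ hQ'.
  by move=> _ /mapP[p /sPQ[_ Qp] ->].
exists n, l, q; split=> //.
under [X in _ - X]eq_bigr => i _ do
  rewrite linear_sum pure_suml.
rewrite exchange_big -sumrB big_seq.
apply: submodule_sum; first exact: subtens_submodule.
move=> p ps; under eq_bigr do rewrite /= contract_pure pureZl -pureZr.
rewrite -pure_sumr.
have -> : pure p.1 p.2 - pure p.1 (\sum_(i < n) (l i p.2 : K) *: q i) =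
          pure p.1 (p.2 - \sum_(i < n) (l i p.2 : K) *: q i).
  by rewrite pureDr -(scaleN1r (\sum_(i < n) _)) pureZr scaleN1r.
by apply: subtens_pure; [case: (sPQ _ ps)|apply: sq; exact: map_f].
Qed.

End Tensors.

Section Kuenneth.
Variables (K : fieldType) (L N : dgla K) (phi : dgla_hom L N) (i : int).

Lemma degree_submodule (M : dgla K) j : submodule (@degree K M j).
Proof. exact/subspace_submodule/degree_subspace. Qed.

(** Surjectivity and injectivity in cohomology, expressed with representatives. *)
Lemma cohomology_surj_lift : surjective (cohomology_map phi i) ->
  forall y : N, degree i y -> diff y = 0 ->
  exists u b, [/\ degree i u, diff u = 0, degree (i - 1) b & y = phi u + diff b].
Proof.
move=> surj y hy dy.
have cy : cocycle i y by apply/asboolP.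
have [c] := surj (\pi_(cohomology N i)%qT (exist _ y cy)).
rewrite /cohomology_map => /eqmodP/asboolP[b hb e].
have /asboolP[hu du] := valP (repr c).
exists (val (repr c)), (- b); split=> //.
  by apply: submoduleN => //; exact: degree_submodule.
by rewrite linearN -e /= opprB addrC subrK.
Qed.

Lemma cohomology_inj_exact : injective (cohomology_map phi i) ->
  forall (u : L) (b : N), degree i u -> diff u = 0 -> degree (i - 1) b ->
  phi u = diff b -> exists2 e, degree (i - 1) e & u = diff e.
Proof.
move=> inj u b hu du hb ub.
have [Z0 _ _] := @degree_submodule L i.
have cu : cocycle i u by apply/asboolP.
have c0 : cocycle i (0 : L) by apply/asboolP; rewrite linear0.
have : \pi_(cohomology L i)%qT (exist _ u cu) = \pi_(cohomology L i)%qT (exist _ 0 c0).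
  apply: inj; rewrite !cohomology_mapE; apply/eqmodP/asboolP; exists b => //=.
  by rewrite linear0 subr0.
by move=> /eqmodP/asboolP[e he /=]; rewrite subr0; exists e.
Qed.

Variable V : lmodType K.

(** The differential of a DGLA and a DGLA morphism, extended to tensors. *)
Local Notation td := (tens_map diff (@idfun V)).
Local Notation tphi := (tens_map phi (@idfun V)).

(** The surjectivity of [H^i(phi)] with coefficients in [Q], modulo [Q']. *)
Lemma kuenneth_surj (Q Q' : set V) y : surjective (cohomology_map phi i) ->
  submodule Q -> submodule Q' ->
  subtens (degree i) Q y -> subtens setT Q' (td y) ->
  exists w b, [/\ subtens (degree i) Q w, td w = 0, subtens (degree (i - 1)) Q b &
                  subtens (degree i) Q' (y - (tphi w + td b))].
Proof.
move=> surj hQ hQ' yQ dyQ'.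
have [n [l [q [Qq lQ' r]]]] := tens_decomposition (@degree_submodule N i) hQ hQ' yQ.
have ex j : exists c : L * N, [/\ degree i c.1, diff c.1 = 0, degree (i - 1) c.2 &
    contract (l j) y = phi c.1 + diff c.2].
  suff [u [b h]] : exists u b, [/\ degree i u, diff u = 0, degree (i - 1) b &
    contract (l j) y = phi u + diff b] by exists (u, b).
  apply: cohomology_surj_lift => //.
    exact: contract_subtens (@degree_submodule N i) yQ.
  rewrite -(@contract_map _ _ _ _ _ diff idfun (l j) (l j)) //.
  exact: contract_eq0 (lQ' j) dyQ'.
pose u j := (sval (cid (ex j))).1; pose b j := (sval (cid (ex j))).2.
have ub j : [/\ degree i (u j), diff (u j) = 0, degree (i - 1) (b j) &
    contract (l j) y = phi (u j) + diff (b j)].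
  exact: svalP (cid (ex j)).
exists (\sum_(j < n) pure (u j) (q j)), (\sum_(j < n) pure (b j) (q j)); split.
- apply: submodule_sum; first exact/subtens_submodule/degree_submodule.
  by move=> j _; apply: subtens_pure => //; case: (ub j).
- rewrite linear_sum big1 // => j _; rewrite /= tens_map_pure.
  by case: (ub j) => _ -> _ _; rewrite pure0l.
- apply: submodule_sum; first exact/subtens_submodule/degree_submodule.
  by move=> j _; apply: subtens_pure => //; case: (ub j).
have -> : tphi (\sum_(j < n) pure (u j) (q j)) + td (\sum_(j < n) pure (b j) (q j)) =
    \sum_(j < n) pure (contract (l j) y) (q j).
  rewrite !linear_sum -big_split; apply: eq_bigr => j _.
  by rewrite /= !tens_map_pure -pureDl; case: (ub j) => _ _ _ ->.
exact: r.
Qed.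

(** The injectivity of [H^i(phi)] with coefficients in [Q], modulo [Q']. *)
Lemma kuenneth_inj (Q Q' Q0 : set V) x b : injective (cohomology_map phi i) ->
  submodule Q -> submodule Q' ->
  subtens (degree i) Q x -> subtens setT Q' (td x) ->
  subtens (degree (i - 1)) Q0 b -> subtens setT Q' (tphi x - td b) ->
  exists2 e, subtens (degree (i - 1)) Q e & subtens (degree i) Q' (x - td e).
Proof.
move=> inj hQ hQ' xQ dxQ' bQ0 xb.
have [n [l [q [Qq lQ' r]]]] := tens_decomposition (@degree_submodule L i) hQ hQ' xQ.
have ex j : exists2 e, degree (i - 1) e & contract (l j) x = diff e.
  apply: (cohomology_inj_exact inj (b := contract (l j) b)).
  - exact: contract_subtens (@degree_submodule L i) xQ.
  - rewrite -(@contract_map _ _ _ _ _ diff idfun (l j) (l j)) //.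
    exact: contract_eq0 (lQ' j) dxQ'.
  - exact: contract_subtens (@degree_submodule N (i - 1)) bQ0.
  - apply/eqP; rewrite -subr_eq0 -(@contract_map _ _ _ _ _ phi idfun (l j) (l j)) //.
    rewrite -(@contract_map _ _ _ _ _ diff idfun (l j) (l j)) // -contractB; apply/eqP.
    exact: contract_eq0 (lQ' j) xb.
pose e j := s2val (cid2 (ex j)).
exists (\sum_(j < n) pure (e j) (q j)).
  apply: submodule_sum; first exact/subtens_submodule/degree_submodule.
  by move=> j _; apply: subtens_pure => //; exact: s2valP (cid2 (ex j)).
have -> : td (\sum_(j < n) pure (e j) (q j)) = \sum_(j < n) pure (contract (l j) x) (q j).
  rewrite linear_sum; apply: eq_bigr => j _.
  by rewrite /= tens_map_pure (s2valP' (cid2 (ex j))).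
exact: r.
Qed.

End Kuenneth.

(** Exactness of the tensor product: a tensor killed by [id (x) p] comes from the
    kernel of [p]. *)
Lemma tens_map_ker (K : fieldType) (U V W : lmodType K) (p : {linear V -> W})
    (P : set U) (Q : set V) x :
  surjective p -> submodule P -> submodule Q -> subtens P Q x ->
  tens_map idfun p x = 0 -> subtens P [set v | p v = 0] x.
Proof.
move=> surj hP hQ xQ px.
have hp : submodule [set v | p v = 0].
  split=> [|v w /= v0 w0|a v /= v0]; first exact: linear0.
    by rewrite linearD v0 w0 addr0.
  by rewrite linearZ /= v0 scaler0.
have [n [l [q [Qq lp]]]] := tens_decomposition hP hQ hp xQ.
rewrite big1 ?subr0 // => j _.
(* A functional vanishing on the kernel of p factors through p. *)
have ex (w : W) : exists v, p v = w := surj w.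
pose s w := sval (cid (ex w)); have sK w : p (s w) = w by rewrite /s; case: cid.
have ls v v' : p v = p v' -> l j v = l j v'.
  move=> e; apply/eqP; rewrite -subr_eq0 -linearB; apply/eqP/lp.
  by rewrite /= linearB e subrr.
pose m w := l j (s w).
have lin : linear m.
  by move=> a w w'; rewrite /m -linearP; apply: ls; rewrite linearP !sK.
pose M : {linear W -> K^o} := HB.pack m (GRing.isLinear.Build K W K^o *:%R m lin).
suff -> : contract (l j) x = 0 by rewrite pure0l.
rewrite -[contract _ _]/(idfun (contract (l j) x)).
rewrite -(@contract_map _ _ _ _ _ idfun p (l j) M) ?px ?linear0 // => v.
by apply: ls; rewrite sK.
Qed.

(** * The graded Lie algebra structure on tensors *)

Section TensorDgla.
Variables (K : fieldType) (L : dgla K) (A : art K).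
Local Notation T := (tens L A).
Implicit Types x y z : T.

Lemma tbracket_pure u (a : A) v b :
  tbracket (pure u a : T) (pure v b) = pure (bracket u v) (a * b).
Proof.
have := @tbracket_sum K L A unit unit [:: tt] [:: tt] (fun=> u) (fun=> a) (fun=> v) (fun=> b).
by rewrite !big_seq1.
Qed.

Lemma tbracket_linear_l y : linear (fun x => tbracket x y).
Proof. exact/tens_lift_linear/tbracket_bilinear. Qed.

Lemma tbracket_linear_r x : linear (tbracket x).
Proof.
move=> k y z; have [s ->] := tens_spanned x.
have [t ->] := tens_spanned y; have [r ->] := tens_spanned z.
have -> : k *: (\sum_(p <- t) pure p.1 p.2 : T) = \sum_(p <- t) pure p.1 (k *: p.2).
  by rewrite scaler_sumr; apply: eq_bigr => p _; rewrite pureZr.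
rewrite -(big_map (fun p => (p.1, k *: p.2)) xpredT (fun p => pure p.1 p.2)).
rewrite -big_cat !tbracket_sum scaler_sumr -big_split; apply: eq_bigr => p _ /=.
rewrite big_cat big_map /= scaler_sumr; congr (_ + _).
by apply: eq_bigr => q _; rewrite -scalerAr pureZr.
Qed.

HB.instance Definition _ x := GRing.isLinear.Build K T T *:%R (tbracket x)
  (tbracket_linear_r x).

Lemma tbracketDl x y z : tbracket (x + y) z = tbracket x z + tbracket y z.
Proof. by have /= := tbracket_linear_l z 1 x y; rewrite !scale1r. Qed.

Lemma tbracket0l z : tbracket 0 z = 0.
Proof. by have /= := tbracket_linear_l z (-1) 0 0; rewrite !scaleN1r !addNr. Qed.

Lemma tbracketZl k x z : tbracket (k *: x) z = k *: tbracket x z.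
Proof. by have /= := tbracket_linear_l z k x 0; rewrite tbracket0l !addr0. Qed.

Lemma tbracketNl x z : tbracket (- x) z = - tbracket x z.
Proof. by rewrite -scaleN1r tbracketZl scaleN1r. Qed.

Lemma tbracketBl x y z : tbracket (x - y) z = tbracket x z - tbracket y z.
Proof. by rewrite tbracketDl tbracketNl. Qed.

Lemma tbracketDr x y z : tbracket x (y + z) = tbracket x y + tbracket x z.
Proof. exact: linearD. Qed.

Lemma tbracketBr x y z : tbracket x (y - z) = tbracket x y - tbracket x z.
Proof. exact: linearB. Qed.

Lemma tbracketZr k x y : tbracket x (k *: y) = k *: tbracket x y.
Proof. exact: linearZ. Qed.

Lemma tbracket0r x : tbracket x 0 = 0.
Proof. exact: linear0. Qed.

Lemma tdiff_linear : linear (@tdiff K L A).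
Proof. exact: tens_map_linear. Qed.

HB.instance Definition _ := GRing.isLinear.Build K T T *:%R (@tdiff K L A) tdiff_linear.

Lemma tdiffD x y : tdiff (x + y) = tdiff x + tdiff y.
Proof. exact: linearD. Qed.

Lemma tdiffB x y : tdiff (x - y) = tdiff x - tdiff y.
Proof. exact: linearB. Qed.

Lemma tdiffN x : tdiff (- x) = - tdiff x.
Proof. exact: linearN. Qed.

Lemma tdiffZ k x : tdiff (k *: x) = k *: tdiff x.
Proof. exact: linearZ. Qed.

Lemma tdiff_pure u (a : A) : tdiff (pure u a : T) = pure (diff u) a.
Proof. exact: tens_map_pure. Qed.

Lemma tbracket_subtens (P1 P2 P3 : set L) (Q1 Q2 Q3 : set A) x y :
  submodule P3 ->
  (forall u v, P1 u -> P2 v -> P3 (bracket u v)) ->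
  (forall a b, Q1 a -> Q2 b -> Q3 (a * b)) ->
  subtens P1 Q1 x -> subtens P2 Q2 y -> subtens P3 Q3 (tbracket x y).
Proof.
move=> hP3 PP QQ xP yP; have [S0 SD _] := @subtens_submodule _ _ _ _ Q3 hP3.
apply: (subtens_ind (C := fun x => subtens P3 Q3 (tbracket x y)) _ _ _ xP).
- by rewrite tbracket0l.
- by move=> x1 x2 h1 h2; rewrite tbracketDl; exact: SD.
move=> u a Pu Qa.
apply: (subtens_ind (C := fun y => subtens P3 Q3 (tbracket (pure u a) y)) _ _ _ yP).
- by rewrite linear0.
- by move=> x1 x2 h1 h2; rewrite linearD; exact: SD.
by move=> v b Pv Qb; rewrite tbracket_pure; apply: subtens_pure; [exact: PP|exact: QQ].
Qed.

(** [tdeg i] is the degree [i] part of the tensor product. *)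
Definition tdeg (i : int) : set T := subtens (degree i) setT.

Lemma subtens_tdeg i (Q : set A) x : subtens (degree i) Q x -> tdeg i x.
Proof. exact: subtens_subset. Qed.

Lemma tbracket_skew i j x y : tdeg i x -> tdeg j y ->
  tbracket x y = - ((-1 : K) ^ (i * j) *: tbracket y x).
Proof.
move=> xi yj.
apply: (subtens_ind (C := fun x => tbracket x y = - (_ *: tbracket y x)) _ _ _ xi).
- by rewrite tbracket0l linear0 ?scaler0 ?oppr0.
- by move=> x1 x2 h1 h2; rewrite tbracketDl h1 h2 linearD /= ?scalerDr opprD.
move=> u a ui _.
apply: (subtens_ind (C := fun y => tbracket _ y = - (_ *: tbracket y _)) _ _ _ yj).
- by rewrite tbracket0l linear0 ?scaler0 ?oppr0.
- by move=> x1 x2 h1 h2; rewrite tbracketDl linearD /= h1 h2 ?scalerDr opprD.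
move=> v b vj _; rewrite !tbracket_pure (bracket_skew ui vj) [a * b]mulrC.
by rewrite -scaleN1r !pureZl scaleN1r.
Qed.

Lemma tbracket_jacobi i j x y z : tdeg i x -> tdeg j y ->
  tbracket x (tbracket y z) =
  tbracket (tbracket x y) z + (-1 : K) ^ (i * j) *: tbracket y (tbracket x z).
Proof.
move=> xi yj.
apply: (subtens_ind (C := fun x => tbracket x (tbracket y z) =
  tbracket (tbracket x y) z + _ *: tbracket y (tbracket x z)) _ _ _ xi).
- by rewrite !tbracket0l linear0 ?scaler0 ?addr0.
- move=> x1 x2 h1 h2; rewrite !tbracketDl h1 h2 linearD /= ?scalerDr.
  by rewrite addrACA.
move=> u a ui _.
apply: (subtens_ind (C := fun y => tbracket _ (tbracket y z) =
  tbracket (tbracket _ y) z + _ *: tbracket y (tbracket _ z)) _ _ _ yj).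
- by rewrite !tbracket0l !linear0 tbracket0l ?scaler0 ?addr0.
- move=> x1 x2 h1 h2; rewrite !tbracketDl !linearD /= h1 h2 tbracketDl ?scalerDr.
  by rewrite addrACA.
move=> v b vj _; elim/tens_ind: z => [|x1 x2 h1 h2|w c].
- by rewrite !linear0 ?scaler0 ?addr0.
- by rewrite !linearD /= h1 h2 ?scalerDr addrACA.
rewrite !tbracket_pure (bracket_jacobi _ ui vj) pureDl pureZl.
by rewrite mulrA [b * (a * c)]mulrA [b * a]mulrC -mulrA.
Qed.

Lemma tdiff_bracket i x y : tdeg i x ->
  tdiff (tbracket x y) = tbracket (tdiff x) y + (-1 : K) ^ i *: tbracket x (tdiff y).
Proof.
move=> xi.
apply: (subtens_ind (C := fun x => tdiff (tbracket x y) =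
  tbracket (tdiff x) y + _ *: tbracket x (tdiff y)) _ _ _ xi).
- by rewrite linear0 !tbracket0l linear0 ?scaler0 ?addr0.
- by move=> x1 x2 h1 h2; rewrite linearD /= !tbracketDl linearD /= h1 h2 ?scalerDr addrACA.
move=> u a ui _; elim/tens_ind: y => [|x1 x2 h1 h2|v b].
- by rewrite !linear0 ?scaler0 ?addr0.
- by rewrite !linearD /= h1 h2 ?scalerDr addrACA.
by rewrite !(tdiff_pure, tbracket_pure) (diff_bracket _ ui) pureDl pureZl.
Qed.

Lemma tdiff_diff x : tdiff (tdiff x) = 0.
Proof.
elim/tens_ind: x => [|x y hx hy|u a]; first by rewrite !linear0.
  by rewrite !linearD /= hx hy addr0.
by rewrite !tdiff_pure diff_diff pure0l.
Qed.

Lemma tdiff_subtens i (Q : set A) x :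
  subtens (degree i) Q x -> subtens (degree (i + 1)) Q (tdiff x).
Proof.
apply: tens_map_subtens => //; first exact: degree_submodule.
exact: diff_degree.
Qed.

Lemma tbracket_degree i j (Q1 Q2 Q3 : set A) x y :
  (forall a b, Q1 a -> Q2 b -> Q3 (a * b)) ->
  subtens (degree i) Q1 x -> subtens (degree j) Q2 y ->
  subtens (degree (i + j)) Q3 (tbracket x y).
Proof.
apply: tbracket_subtens; first exact: degree_submodule.
exact: bracket_degree.
Qed.

End TensorDgla.

(** * Endomorphisms of a filtered module *)

(** A nonzero module with a descending filtration that starts with the whole
    module. *)
Record filtered_module (K : fieldType) := FilteredModule {
  fm_sort :> lmodType K;
  fm_step : nat -> set fm_sort;
  fm_submodule : forall n, submodule (fm_step n);
  fm_total : forall v, fm_step 0 v;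
  fm_desc : forall n, fm_step n.+1 `<=` fm_step n;
  fm_nontrivial : exists v : fm_sort, v != 0 }.

Section Endomorphisms.
Variables (K : fieldType) (M : filtered_module K).

(** Linear endomorphisms that preserve the filtration. *)
Record endo := Endo {
  endo_fun :> M -> M;
  endo_linear : linear endo_fun;
  endo_step : forall n v, fm_step n v -> fm_step n (endo_fun v) }.

(** Endomorphisms form a ring under composition, in which the scalars are
    central. *)
HB.instance Definition _ := gen_eqMixin endo.
HB.instance Definition _ := gen_choiceMixin endo.

Lemma endo_ext (f g : endo) : f =1 g -> f = g.
Proof.
case: f g => [f fl fs] [g gl gs] /= /funext e.
case: g / e gl gs => gl gs.
by rewrite (Prop_irrelevance fl gl) (Prop_irrelevance fs gs).
Qed.

Definition endo_zero : endo.
Proof.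
refine (@Endo (fun=> 0) _ _); first by move=> a x y; rewrite scaler0 addr0.
by move=> n v _; case: (@fm_submodule K M n).
Defined.

Definition endo_opp (f : endo) : endo.
Proof.
refine (@Endo (fun v => - f v) _ _).
  by move=> a x y; rewrite endo_linear opprD scalerN.
by move=> n v /(endo_step f); apply: submoduleN; exact: fm_submodule.
Defined.

Definition endo_add (f g : endo) : endo.
Proof.
refine (@Endo (fun v => f v + g v) _ _).
  by move=> a x y; rewrite !endo_linear scalerDr addrACA.
move=> n v vn; have [_ D _] := @fm_submodule K M n.
by apply: D; exact: endo_step.
Defined.

Definition endo_one : endo := @Endo id (fun _ _ _ => erefl) (fun _ _ h => h).

Definition endo_mul (f g : endo) : endo.
Proof.
refine (@Endo (fun v => f (g v)) _ _); first by move=> a x y; rewrite !endo_linear.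
by move=> n v vn; do 2! apply: endo_step.
Defined.

Definition endo_scalar (k : K) : endo.
Proof.
refine (@Endo (fun v => k *: v) _ _).
  by move=> a x y; rewrite scalerDr !scalerA mulrC.
by move=> n v; case: (@fm_submodule K M n) => _ _; exact.
Defined.

Fact endo_addA : associative endo_add.
Proof. by move=> f g h; apply: endo_ext => v /=; rewrite addrA. Qed.
Fact endo_addC : commutative endo_add.
Proof. by move=> f g; apply: endo_ext => v /=; rewrite addrC. Qed.
Fact endo_add0 : left_id endo_zero endo_add.
Proof. by move=> f; apply: endo_ext => v /=; rewrite add0r. Qed.
Fact endo_addN : left_inverse endo_zero endo_opp endo_add.
Proof. by move=> f; apply: endo_ext => v /=; rewrite addNr. Qed.
HB.instance Definition _ :=
  GRing.isZmodule.Build endo endo_addA endo_addC endo_add0 endo_addN.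

Fact endo_mulA : associative endo_mul.
Proof. by move=> f g h; apply: endo_ext. Qed.
Fact endo_mul1 : left_id endo_one endo_mul.
Proof. by move=> f; apply: endo_ext. Qed.
Fact endo_mulr1 : right_id endo_one endo_mul.
Proof. by move=> f; apply: endo_ext. Qed.
Fact endo_mulDl : left_distributive endo_mul endo_add.
Proof. by move=> f g h; apply: endo_ext. Qed.
Fact endo_mulDr : right_distributive endo_mul endo_add.
Proof.
move=> f g h; apply: endo_ext => v /=.
by have := endo_linear f 1 (g v) (h v); rewrite !scale1r.
Qed.
Fact endo_one_neq0 : endo_one != endo_zero.
Proof.
have [v v0] := fm_nontrivial M; apply/eqP => e; move: v0.
by rewrite -[v]/(endo_one v) e eqxx.
Qed.
HB.instance Definition _ := GRing.Zmodule_isNzRing.Build endo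
  endo_mulA endo_mul1 endo_mulr1 endo_mulDl endo_mulDr endo_one_neq0.

Fact endo_scalar_zmod : zmod_morphism endo_scalar.
Proof. by move=> a b; apply: endo_ext => v; rewrite /= scalerBl. Qed.
Fact endo_scalar_monoid : monoid_morphism endo_scalar.
Proof.
split; first by apply: endo_ext => v; rewrite /= scale1r.
by move=> a b; apply: endo_ext => v; rewrite /= scalerA.
Qed.
HB.instance Definition _ := GRing.isZmodMorphism.Build K endo endo_scalar endo_scalar_zmod.
HB.instance Definition _ := GRing.isMonoidMorphism.Build K endo endo_scalar endo_scalar_monoid.

Lemma endo_scalarC k (f : endo) : endo_scalar k * f = f * endo_scalar k.
Proof.
apply: endo_ext => v /=; have := endo_linear f k v 0.
have -> : f 0 = 0; last by rewrite !addr0.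
by have := endo_linear f (-1) 0 0; rewrite !scaleN1r !addNr.
Qed.

Lemma endo_sumE n (F : 'I_n -> endo) v : (\sum_(i < n) F i) v = \sum_(i < n) F i v.
Proof. by apply: (big_morph (fun f : endo => f v)). Qed.

Lemma endo_rexpE n (f : endo) v :
  rexp endo_scalar n f v = \sum_(i < n) exp_coef K i *: iter i f v.
Proof.
rewrite /rexp endo_sumE; apply: eq_bigr => i _ /=; congr (_ *: _).
by elim: (nat_of_ord i) => [//|j ih]; rewrite exprS /= -ih.
Qed.

(** Endomorphisms that raise the filtration by at least [n] steps. *)
Definition endo_filt (n : nat) : set endo :=
  [set f | forall k v, fm_step k v -> fm_step (n + k) (f v)].

Lemma endo_filtration N : (forall v : M, fm_step N v -> v = 0) -> filtration endo_filt N.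
Proof.
move=> MN; split.
- by move=> n k v _; case: (@fm_submodule K M (n + k)).
- move=> n f g If Ig k v vk; have [_ D _] := @fm_submodule K M (n + k).
  by apply: D; [exact: If|exact: Ig].
- by move=> i j f g If Ig k v vk; rewrite -addnA; apply: If; exact: Ig.
- by move=> f k v; exact: endo_step.
- by move=> n f If k v vk; apply: fm_desc; exact: If.
- move=> f If; apply: endo_ext => v; apply: MN.
  by have := If 0%N v (fm_total v); rewrite addn0.
Qed.

End Endomorphisms.

(** * The gauge action *)

Section Gauge.
Variables (K : fieldType) (L : dgla K) (A : art K).
Hypothesis charK : [pchar K] =i pred0.
Local Notation T := (tens L A).
Local Notation F n := (subtens (@setT L) (@mpow K A n)).

(** The gauge action is affine.  It becomes linear on the sum of [T] and a line
    spanned by a formal element of degree 1 whose bracket with [x] is [d x]: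
    [x] corresponds to the pair [(x, 1)], and [rho a] is the bracket with [a]. *)
Definition gauge_space : lmodType K := (T * K^o)%type.

Definition rho (a : T) (v : gauge_space) : gauge_space :=
  (tbracket a v.1 - (v.2 : K) *: tdiff a, 0).

(** The filtration of [gauge_space] by powers of the maximal ideal; the line
    belongs to step 0 only. *)
Definition gauge_step (n : nat) : set gauge_space :=
  [set v | F n v.1 /\ ((0 < n)%N -> v.2 = 0)].

Lemma tens_mpow_submodule n : submodule (F n).
Proof. exact: subtens_submodule. Qed.

Fact gauge_step_submodule n : submodule (gauge_step n).
Proof.
have [F0 FD FZ] := tens_mpow_submodule n; split.
- by split=> //; exact: F0.
- move=> v w [v1 v2] [w1 w2]; split=> [|n0]; first exact: FD.
  by rewrite /= v2 // w2 // addr0.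
- move=> a v [v1 v2]; split=> [|n0]; first exact: FZ.
  by rewrite /= v2 // scaler0.
Qed.

Fact gauge_step_total v : gauge_step 0 v.
Proof. by split=> //; exact: subtensT. Qed.

Fact gauge_step_desc n : gauge_step n.+1 `<=` gauge_step n.
Proof.
move=> v [v1 v2]; split=> [|_]; last exact: v2.
by apply: subtens_subset v1 => //; exact: mpowS.
Qed.

Fact gauge_space_nontrivial : exists v : gauge_space, v != 0.
Proof.
exists (0, 1); apply/eqP => -[] /eqP; apply/negP.
exact: oner_neq0.
Qed.

Definition gauge_module : filtered_module K :=
  FilteredModule gauge_step_submodule gauge_step_total gauge_step_desc
    gauge_space_nontrivial.

Lemma rho_linear a : linear (rho a).
Proof.
move=> k v w; rewrite /rho; congr (_, _); last by rewrite /= scaler0 addr0.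
rewrite /= linearP scalerDl -[(k *: v.2) *: _]scalerA scalerBr opprD.
by rewrite addrACA.
Qed.

Lemma rho_linear_l k a b v : rho (k *: a + b) v = k *: rho a v + rho b v.
Proof.
rewrite /rho; congr (_, _); last by rewrite /= scaler0 addr0.
rewrite /= tbracketDl tbracketZl linearP scalerDr !scalerA opprD scalerBr scalerA.
by rewrite [v.2 * k]mulrC addrACA.
Qed.

Lemma rho_step a : F 1 a -> forall n v, gauge_step n v -> gauge_step n.+1 (rho a v).
Proof.
move=> Fa n v [v1 v2]; split=> //=; apply: (submoduleB (tens_mpow_submodule n.+1)).
  apply: tbracket_subtens Fa v1 => //.
  by move=> b c mb mc; apply: idealM_mul => //; rewrite -mpow1.
have [_ _ FZ] := tens_mpow_submodule n.+1.
case: n v1 v2 FZ => [_ _|n _ /(_ isT) ->] FZ; last by rewrite scale0r; case: (tens_mpow_submodule n.+2).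
by apply: FZ; apply: tens_map_subtens Fa.
Qed.

(** Outside of the nilpotent part, where [rho a] need not respect the
    filtration, the value is irrelevant. *)
Definition Rho (a : T) : endo gauge_module :=
  if pselect (F 1 a) is left Fa then
    @Endo _ gauge_module (rho a) (rho_linear a)
      (fun n v vn => gauge_step_desc (rho_step Fa vn))
  else 0.

Lemma RhoE a : F 1 a -> Rho a =1 rho a.
Proof. by rewrite /Rho; case: pselect. Qed.

Lemma tpart_F a i : tpart i a -> F 1 a.
Proof. by rewrite mpow1; apply: subtens_subset. Qed.

Lemma iter_rho a x n :
  iter n.+1 (rho a) (x, 1) = (iter n (tbracket a) (tbracket a x - tdiff a), 0).
Proof.
elim: n => [|n ih]; first by rewrite /rho /= scale1r.
by rewrite iterS ih /rho /= scale0r subr0.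
Qed.

Lemma iter_rho_step a n v : F 1 a -> gauge_step n (iter n (rho a) v).
Proof.
move=> Fa; elim: n => [|n ih]; first exact: gauge_step_total.
exact: rho_step.
Qed.

Section Nilpotent.
Variable N : nat.
Hypothesis HN : forall n, (N <= n)%N -> @mpow K A n = [set 0].

Lemma nilpotency_gt0 : (0 < N)%N.
Proof.
rewrite lt0n; apply/eqP => N0; have /= h := HN (n := 0); rewrite N0 in h.
have : [set: A] 1 by []. 
by rewrite h //= => /eqP; rewrite oner_eq0.
Qed.

Lemma F_eq0 n x : (N <= n)%N -> F n x -> x = 0.
Proof. by move=> /HN ->; exact: subtens_zero. Qed.

Lemma gauge_step_eq0 n v : (N <= n)%N -> gauge_step n v -> v = 0.
Proof.
move=> Nn [/(F_eq0 Nn) v1 v2]; rewrite [v]surjective_pairing v1 v2 //.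
exact: leq_trans nilpotency_gt0 Nn.
Qed.

Lemma iter_rho_eq0 a n v : F 1 a -> (N <= n)%N -> iter n (rho a) v = 0.
Proof. by move=> Fa Nn; apply: (gauge_step_eq0 Nn); exact: iter_rho_step. Qed.

(** The support of the sum in [gauge] is finite, as [m] is nilpotent. *)
Lemma gauge_sum a x n : F 1 a -> (N <= n.+1)%N ->
  gauge a x = x + \sum_(i < n) exp_coef K i.+1 *:
    iter i (tbracket a) (tbracket a x - tdiff a).
Proof.
move=> Fa Nn; congr (_ + _).
rewrite -(fsbig_widen `I_n [set: nat]) // -?fsbig_ord //.
move=> i [_ /= /negP]; rewrite -leqNgt => ni.
have := @iter_rho_eq0 a i.+1 (x, 1) Fa (leq_trans Nn (ni : (n < i.+1)%N)).
by rewrite iter_rho => -[->]; rewrite scaler0.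
Qed.

Lemma gauge_iter a x n : F 1 a -> (N <= n)%N ->
  (gauge a x, 1) = \sum_(i < n) exp_coef K i *: iter i (rho a) (x, 1).
Proof.
move=> Fa; case: n => [|n Nn]; first by rewrite leqNgt nilpotency_gt0.
pose G i := exp_coef K i.+1 *: iter i (tbracket a) (tbracket a x - tdiff a).
have GE m : (\sum_(i < m) G i, 0) = \sum_(i < m) ((G i, 0) : gauge_space).
  elim: m => [|m ih]; first by rewrite !big_ord0.
  by rewrite !big_ord_recr /= -ih; congr (_, _); rewrite /= addr0.
rewrite big_ord_recl exp_coef0 scale1r (gauge_sum x Fa Nn).
transitivity ((x, 1) + (\sum_(i < n) G i, 0) : gauge_space).
  by congr (_, _); rewrite /= addr0.
congr (_ + _); rewrite GE; apply: eq_bigr => i _.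
by rewrite iter_rho; congr (_, _); rewrite /= scaler0.
Qed.

(** The gauge action as an exponential of operators. *)
Lemma gauge_rexp a x : F 1 a -> (gauge a x, 1) = rexp (@endo_scalar K gauge_module) N (Rho a) (x, 1).
Proof.
move=> Fa; rewrite endo_rexpE (gauge_iter x Fa (leqnn N)).
apply: eq_bigr => i _; congr (_ *: _).
by elim: (nat_of_ord i) => [//|j /= ->]; rewrite RhoE.
Qed.

End Nilpotent.

Lemma gauge0 x : gauge 0 x = x :> T.
Proof.
have [N HN] := maxid_nilpotent A.
rewrite (@gauge_sum N HN 0 x N) ?leqnSn //; last by case: (tens_mpow_submodule 1).
rewrite big1 ?addr0 // => i _.
suff -> : iter i (tbracket 0) (tbracket 0 x - tdiff (0 : T)) = 0 by rewrite scaler0.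
rewrite tbracket0l linear0 subr0.
by elim: (nat_of_ord i) => [//|j /= ->]; rewrite tbracket0l.
Qed.

Lemma tbracket_degree0 a b : tdeg 0 a -> tdeg 0 b -> tbracket a b = - tbracket b a :> T.
Proof. by move=> ha hb; rewrite (tbracket_skew ha hb) mul0r scale1r. Qed.

(** In degree 0, [rho] is a representation of the Lie algebra. *)
Lemma rho_bracket a b v : tdeg 0 a -> tdeg 0 b ->
  rho (tbracket a b) v = rho a (rho b v) - rho b (rho a v).
Proof.
move=> ha hb; rewrite /rho; congr (_, _); last by rewrite /= subr0.
rewrite /= !scale0r !subr0 !tbracketBr (tbracket_jacobi _ ha hb) mul0r scale1r.
rewrite (tdiff_bracket _ ha) expr0z scale1r.
rewrite (_ : tbracket (tdiff a) b = - tbracket b (tdiff a)); last first.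
  by rewrite (tbracket_skew (tdiff_subtens ha) hb) mulr0 scale1r.
rewrite !tbracketZr scalerDr scalerN opprB opprD opprK.
set X := tbracket (tbracket a b) _; set Y := tbracket b (tbracket a _).
set p := _ *: tbracket a _; set q := _ *: tbracket b _.
by rewrite [X + Y]addrC -[Y + X - p]addrA [q - Y]addrC [RHS]addrACA subrr add0r -addrA [- p + q]addrC.
Qed.


(** The gauge actions of the elements of a Lie subalgebra [g] are closed under
    composition; the exponent of a product is known modulo the commutators. *)
Lemma gauge_comp (g h : set T) a b :
  submodule g -> submodule h -> g `<=` tpart 0 -> h `<=` g ->
  (forall x y, g x -> g y -> h (tbracket x y)) -> g a -> g b ->
  exists c, [/\ g c, h (c - (a + b)) & forall x, gauge a (gauge b x) = gauge c x].
Proof.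
move=> [g0 gD gZ] [h0 hD hZ] g0m hg gh ga gb.
have [N HN] := maxid_nilpotent A.
have gF x : g x -> F 1 x by move=> /g0m/tpart_F.
have gdeg x : g x -> tdeg 0 x by move=> /g0m/subtens_tdeg.
pose c : {rmorphism K -> endo gauge_module} := @endo_scalar K gauge_module.
have RhoZD k x y : g x -> g y -> Rho (k *: x + y) = c k * Rho x + Rho y.
  move=> gx gy; apply: endo_ext => v /=; rewrite !RhoE ?rho_linear_l //; try exact: gF.
  by apply: gF; apply: gD => //; exact: gZ.
have RhoZ k x : g x -> Rho (k *: x) = c k * Rho x.
  move=> gx; have := RhoZD k x 0 gx g0; rewrite addr0 => ->.
  have := RhoZD (-1) 0 0 g0 g0; rewrite scaler0 addr0 rmorphN rmorph1 mulN1r addNr => ->.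
  by rewrite addr0.
have RhoD x y : g x -> g y -> Rho (x + y) = Rho x + Rho y.
  by move=> gx gy; rewrite -[x in LHS]scale1r RhoZD // rmorph1 mul1r.
have MN : forall v : gauge_module, fm_step N v -> v = 0.
  by move=> v; exact: (gauge_step_eq0 HN (leqnn N)).
pose gE := [set Rho x | x in g]; pose hE := [set Rho x | x in h].
have imD (s : set T) : s `<=` g -> (forall x y, s x -> s y -> s (x + y)) ->
    forall f f', [set Rho x | x in s] f -> [set Rho x | x in s] f' ->
    [set Rho x | x in s] (f + f').
  move=> sg sD _ _ [x sx <-] [y sy <-]; exists (x + y); first exact: sD.
  by rewrite RhoD //; exact: sg.
have imZ (s : set T) : s `<=` g -> (forall k x, s x -> s (k *: x)) ->
    forall k f, [set Rho x | x in s] f -> [set Rho x | x in s] (c k * f).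
  move=> sg sZ k _ [x sx <-]; exists (k *: x); first exact: sZ.
  by rewrite RhoZ //; exact: sg.
have im0 (s : set T) : s 0 -> [set Rho x | x in s] 0.
  move=> s0; exists 0 => //.
  by rewrite -(scale0r 0) RhoZ // rmorph0 mul0r.
have gE1 : gE `<=` @endo_filt K gauge_module 1.
  move=> _ [x gx <-] k v vk; rewrite RhoE; last exact: gF.
  by apply: rho_step => //; exact: gF.
have ghE f f' : gE f -> gE f' -> hE (f * f' - f' * f).
  move=> [x gx <-] [y gy <-]; exists (tbracket x y); first exact: gh.
  apply: endo_ext => v /=; rewrite !RhoE ?rho_bracket //; try exact: gdeg; try exact: gF.
  by apply/gF/hg/gh.
have hgE : hE `<=` gE by move=> _ [x hx <-]; exists x => //; exact: hg.
have [f [_ [w hw ew] E]] := baker_campbell_hausdorff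
  (fun k f => endo_scalarC k f) charK (endo_filtration MN) (im0 g g0) (imD g (fun _ h => h) gD)
  (imZ g (fun _ h => h) gZ) gE1 (im0 h h0) (imD h hg hD) (imZ h hg hZ) hgE ghE
  (ex_intro2 _ _ a ga erefl) (ex_intro2 _ _ b gb erefl).
have gab : g (a + b) by exact: gD.
exists (a + b + w); split.
- by apply: gD => //; exact: hg.
- by rewrite [a + b + w]addrC addrK.
move=> x; have gw : g w by exact: hg.
have e : f = Rho (a + b + w) by rewrite RhoD // ew RhoD // addrC subrK.
have := congr1 (fun f : endo gauge_module => f (x, 1)) E.
rewrite e /= -(gauge_rexp HN x (gF _ gb)) -!(gauge_rexp HN) //; first by case.
- by apply: gF; exact: gD.
- exact: gF.
Qed.

Lemma tpart_submodule i : submodule (@tpart K L A i).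
Proof. exact/subtens_submodule/degree_submodule. Qed.

Lemma gauge_trans (a b : T) : tpart 0 a -> tpart 0 b ->
  exists2 c, tpart 0 c & forall x, gauge a (gauge b x) = gauge c x.
Proof.
move=> ha hb; have hT := tpart_submodule 0.
have hTT x y : tpart 0 x -> tpart 0 y -> tpart 0 (tbracket x y : T).
  move=> hx hy; rewrite -[0]addr0; apply: tbracket_degree hx hy => u v _ mv.
  by have [_ _ mM] := maxid_ideal A; exact: mM.
have [c [hc _ e]] := gauge_comp hT hT (fun _ h => h) (fun _ h => h) hTT ha hb.
by exists c.
Qed.

Lemma gaugeK (a x : T) : tpart 0 a -> gauge (- a) (gauge a x) = x.
Proof.
(* The line spanned by [a] is an abelian Lie subalgebra. *)
move=> ha; pose g := [set y | exists k : K, y = k *: a].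
have ga k : g (k *: a) by exists k.
have hg : submodule g.
  split; first by rewrite -(scale0r a).
  - by move=> _ _ [k ->] [l ->]; rewrite -scalerDl.
  - by move=> k _ [l ->]; rewrite scalerA.
have h0 : submodule [set (0 : T)].
  by split=> //= [_ _ -> ->|k _ ->]; rewrite ?addr0 ?scaler0.
have aa : tbracket a a = 0.
  have hd := subtens_tdeg ha; have := tbracket_degree0 hd hd.
  move/eqP; rewrite -subr_eq0 opprK -mulr2n -scaler_nat scaler_eq0.
  by rewrite (negPf (natr_neq0 charK 1)) => /eqP.
have g0m : g `<=` tpart 0.
  by move=> _ [k ->]; case: (tpart_submodule 0) => _ _; exact.
have h0g : [set (0 : T)] `<=` g by move=> _ ->; rewrite -(scale0r a).
have gg u v : g u -> g v -> [set (0 : T)] (tbracket u v).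
  by move=> [k ->] [l ->]; rewrite /= tbracketZl tbracketZr aa !scaler0.
have [c [_ /= c0 e]] := gauge_comp hg h0 g0m h0g gg (ga (-1)) (ga 1).
move: c0; rewrite scaleN1r scale1r addNr subr0 => c0.
by have := e x; rewrite scaleN1r scale1r c0 gauge0.
Qed.

(** * The Maurer-Cartan equation *)

(** [x] satisfies the Maurer-Cartan equation iff its curvature vanishes. *)
Definition curvature (x : T) : T := tdiff x + (2%:R^-1 : K) *: tbracket x x.

(** The symmetric bilinear form on [gauge_space] whose value at [(x, 1)] is twice
    the curvature of [x]. *)
Definition cform (v w : gauge_space) : T :=
  (v.2 : K) *: tdiff w.1 + (w.2 : K) *: tdiff v.1 + tbracket v.1 w.1.

Lemma cform_linear_r v : linear (cform v).
Proof.
move=> k w w'; rewrite /cform /= tdiffD tdiffZ tbracketDr tbracketZr scalerDl.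
rewrite -[(k *: w.2) *: _]scalerA !scalerDr !scalerA [v.2 * k]mulrC.
by rewrite [X in X + (_ + tbracket _ _)]addrACA [LHS]addrACA.
Qed.

Lemma cform_linear_l w : linear (cform^~ w).
Proof.
move=> k v v'; rewrite /cform /= tdiffD tdiffZ tbracketDl tbracketZl scalerDl.
rewrite -[(k *: v.2) *: _]scalerA !scalerDr !scalerA [w.2 * k]mulrC.
by rewrite [X in X + (_ + tbracket _ _)]addrACA [LHS]addrACA.
Qed.

Lemma tdeg_submodule i : submodule (@tdeg K L A i).
Proof. exact/subtens_submodule/degree_submodule. Qed.

Lemma rho_deg a v : tdeg 0 a -> tdeg 1 v.1 -> tdeg 1 (rho a v).1.
Proof.
move=> ha hv; rewrite /rho /=; apply: (submoduleB (tdeg_submodule 1)).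
  by rewrite -[1]add0r; exact: tbracket_degree ha hv.
by have [_ _ Z] := tdeg_submodule 1; apply: Z; rewrite -[1]add0r; exact: tdiff_subtens.
Qed.

(** The operators [rho a] act as derivations on [cform], with values acted upon by
    the bracket with [a]; hence their exponentials preserve the zeros of the
    curvature. *)
Lemma cform_derivation a v w : tdeg 0 a -> tdeg 1 v.1 -> tdeg 1 w.1 ->
  tbracket a (cform v w) = cform (rho a v) w + cform v (rho a w).
Proof.
move=> ha hv hw; rewrite /cform /rho /= !scale0r add0r addr0.
have hda : tdeg 1 (tdiff a) by rewrite -[1]add0r; exact: tdiff_subtens.
rewrite !tdiffB !tdiffZ !tdiff_diff !scaler0 !subr0 !(tdiff_bracket _ ha) !expr0z !scale1r.
rewrite !tbracketDr !tbracketZr (tbracket_jacobi _ ha hv) mul0r expr0z scale1r.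
rewrite tbracketBl tbracketZl scaleN1r (tbracket_skew hv hda) mulr1 expr1z scaleN1r opprK.
rewrite !scalerDr.
set q := (w.2 : K) *: tbracket (tdiff a) _; set s := (w.2 : K) *: tbracket a _.
set p := (v.2 : K) *: tbracket (tdiff a) _; set r := (v.2 : K) *: tbracket a _.
set t := tbracket (tbracket a _) _; set u := tbracket _ (tbracket a _).
rewrite [RHS]addrACA [t - p + _]addrACA -opprD [q + s]addrC [p + r]addrC.
by rewrite [s + q + _]addrACA [RHS]addrACA [q + p]addrC subrr addr0 [r + s]addrC.
Qed.

Lemma cform_curvature x : cform (x, 1) (x, 1) = 2%:R *: curvature x.
Proof.
rewrite /cform /curvature /= !scale1r scalerDr scalerA mulfV ?(natr_neq0 charK 1) //.
by rewrite scale1r scaler_nat mulr2n.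
Qed.

HB.instance Definition _ v := GRing.isLinear.Build K gauge_space T *:%R (cform v)
  (cform_linear_r v).

Lemma cformDl u v w : cform (u + v) w = cform u w + cform v w.
Proof. by have := cform_linear_l w 1 u v; rewrite !scale1r. Qed.

Lemma cform0l w : cform 0 w = 0.
Proof. by have := cform_linear_l w (-1) 0 0; rewrite !scaleN1r !addNr. Qed.

Lemma cformZl k v w : cform (k *: v) w = k *: cform v w.
Proof. by have := cform_linear_l w k v 0; rewrite cform0l !addr0. Qed.

Lemma cform0r w : cform w 0 = 0.
Proof. exact: linear0. Qed.

Lemma cformZr k v w : cform w (k *: v) = k *: cform w v.
Proof. exact: linearZ. Qed.

Lemma iter_rho_deg a v i : tdeg 0 a -> tdeg 1 v.1 -> tdeg 1 (iter i (rho a) v).1.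
Proof. by move=> ha hv; elim: i => [//|i ih]; exact: rho_deg. Qed.

Lemma cform_leibniz a v n : tdeg 0 a -> tdeg 1 v.1 ->
  iter n (tbracket a) (cform v v) =
  \sum_(i < n.+1) 'C(n, i)%:R *: cform (iter i (rho a) v) (iter (n - i) (rho a) v).
Proof.
move=> ha hv; elim: n => [|n ih]; first by rewrite big_ord1 scale1r.
rewrite iterS ih linear_sum /=.
under eq_bigr do rewrite tbracketZr (cform_derivation ha (iter_rho_deg _ ha hv) (iter_rho_deg _ ha hv)) scalerDr -!iterS.
rewrite big_split /= addrC.
rewrite [RHS]big_ord_recl; under [X in _ = _ + X]eq_bigr do rewrite lift0 binS natrD scalerDl subSS.
rewrite big_split /= addrA; congr (_ + _).
rewrite [X in _ = _ + X]big_ord_recr /= (@bin_small n n.+1) // scale0r addr0 big_ord_recl /= !bin0 !subn0.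
congr (_ + _); apply: eq_bigr => i _; by rewrite /= /bump leq0n add1n -(iterS (n - i.+1)) subnSK.
Qed.

Lemma gauge_MC (a x : T) : tpart 0 a -> MC x -> MC (gauge a x).
Proof.
move=> ha [hx mc]; have hda := subtens_tdeg ha; have hdx := subtens_tdeg hx.
have Fa := tpart_F ha; have [N HN] := maxid_nilpotent A; split.
  rewrite (@gauge_sum N HN a x N) ?leqnSn //.
  have [_ D Z] := tpart_submodule 1; apply: D => //.
  have br y : tpart 1 y -> tpart 1 (tbracket a y).
    move=> hy; rewrite -[1]add0r; apply: tbracket_degree ha hy => u v _ mv.
    by have [_ _ mM] := maxid_ideal A; exact: mM.
  apply: submodule_sum; first exact: tpart_submodule.
  move=> i _; apply: Z; elim: (nat_of_ord i) => [|j ih]; last exact: br.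
  apply: (submoduleB (tpart_submodule 1)); first exact: br.
  by rewrite -[1]add0r; exact: tdiff_subtens.
rewrite -/(curvature _).
suff : 2%:R *: curvature (gauge a x) = 0.
  by move/eqP; rewrite scaler_eq0 (negPf (natr_neq0 charK 1)) => /eqP.
rewrite -cform_curvature (@gauge_iter N HN a x (N + N)) ?leq_addr //.
set e := fun i => iter i (rho a) (x, 1).
have e0 i : (N <= i)%N -> e i = 0 by exact: iter_rho_eq0.
pose h i j := (exp_coef K i * exp_coef K j) *: cform (e i) (e j).
transitivity (\sum_(i < N + N) \sum_(j < N + N) h i j).
  rewrite (big_morph (cform^~ _) (fun u v => cformDl u v _) (cform0l _)).
  apply: eq_bigr => i _; rewrite (linear_sum (cform _)); apply: eq_bigr => j _.
  by rewrite /= cformZl cformZr scalerA.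
rewrite (@sum_triangle _ _ h) => [|i j Nij].
  rewrite big1 // => n _.
  have := cform_leibniz n hda (v := (x, 1)) hdx.
  rewrite cform_curvature /curvature mc scaler0 => e1.
  have e2 : iter n (tbracket a) 0 = 0.
    by elim: (nat_of_ord n) => [//|m /= ->]; rewrite tbracket0r.
  transitivity (exp_coef K n *: iter n (tbracket a) 0); last by rewrite e2 scaler0.
  rewrite e1 scaler_sumr; apply: eq_bigr => i _.
  by rewrite /h scalerA exp_coef_bin ?[exp_coef K i * _]mulrC // -ltnS.
have [Ni|iN] := leqP N i; first by rewrite /h e0 // cform0l scaler0.
rewrite /h (e0 j) ?cform0r ?scaler0 //.
by lia.
Qed.

End Gauge.

Section CurvatureIdentities.
Variables (K : fieldType) (L : dgla K) (A : art K).
Hypothesis charK : [pchar K] =i pred0.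
Local Notation T := (tens L A).

Lemma tbracket_sym1 (x y : T) : tdeg 1 x -> tdeg 1 y -> tbracket x y = tbracket y x.
Proof. by move=> hx hy; rewrite (tbracket_skew hx hy) mulr1 expr1z scaleN1r opprK. Qed.

Lemma half_double (V : lmodType K) (v : V) : (2%:R^-1 : K) *: (v + v) = v.
Proof.
by rewrite -mulr2n -scaler_nat scalerA mulVf ?scale1r // (natr_neq0 charK 1).
Qed.

Lemma curvatureD (x u : T) : tdeg 1 x -> tdeg 1 u ->
  curvature (x + u) = curvature x + (tdiff u + (tbracket x u + (2%:R^-1 : K) *: tbracket u u)).
Proof.
move=> hx hu; rewrite /curvature tdiffD !tbracketDl !tbracketDr (tbracket_sym1 hu hx).
rewrite [tbracket x u + tbracket u u]addrC [X in _ *: X]addrACA !(scalerDr _ (_ + _)).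
rewrite half_double scalerDr -[_ *: _ + _ + tbracket x u]addrA addrACA.
by rewrite [tbracket x u + _]addrC.
Qed.

(** The Bianchi identity. *)
Lemma tdiff_curvature (x : T) : tdeg 1 x -> tdiff (curvature x) = - tbracket x (curvature x).
Proof.
move=> hx; have hdx : tdeg 2 (tdiff x) := tdiff_subtens hx.
have hxx : tdeg 2 (tbracket x x).
  by apply: (tbracket_degree _ hx hx) => a b.
have xxx : tbracket x (tbracket x x) = 0.
  have := tbracket_jacobi x hx hx.
  rewrite (tbracket_skew hxx hx) mulr1 expr1z scaleN1r (_ : (-1) ^ 2 = 1 :> K); last first.
    by rewrite -exprnP sqrrN expr1n.
  rewrite scale1r -opprD => /eqP; rewrite -subr_eq0 opprK.
  rewrite -mulr2n -mulrS -scaler_nat scaler_eq0 (negPf (natr_neq0 charK 2)) => /eqP.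
  exact.
rewrite /curvature tdiffD tdiff_diff add0r tdiffZ (tdiff_bracket _ hx) expr1z scaleN1r.
rewrite (tbracket_skew hdx hx) mulr1 (_ : (-1) ^ 2 = 1 :> K); last first.
  by rewrite -exprnP sqrrN expr1n.
rewrite scale1r -opprD scalerN half_double.
by rewrite tbracketDr tbracketZr xxx scaler0 addr0.
Qed.

(** Degree [-1] elements provide elements of the stabiliser of a Maurer-Cartan
    element. *)
Lemma gauge_stabiliser (y f : T) : MC y -> subtens (degree (-1)) (@maxid K A) f ->
  gauge (tdiff f + tbracket y f) y = y.
Proof.
move=> [hy mc] hf; set s := _ + _.
have ty := subtens_tdeg hy; have tf := subtens_tdeg hf.
have hdf : tpart 0 (tdiff f) := tdiff_subtens hf.
have hyf : tpart 0 (tbracket y f).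
  apply: (@tbracket_degree _ _ _ 1 (-1) _ _ _ _ _ _ hy hf) => u v _ mv.
  by have [_ _ mM] := maxid_ideal A; exact: mM.
have hs : tpart 0 s by have [_ D _] := @tpart_submodule _ L A 0; exact: D.
have yyf : tbracket y (tbracket y f) = (2%:R^-1 : K) *: tbracket (tbracket y y) f.
  rewrite -[LHS]half_double; congr (_ *: _).
  rewrite {1}(tbracket_jacobi f ty ty) mulr1 expr1z scaleN1r.
  by rewrite subrK.
have s0 : tbracket s y - tdiff s = 0.
  rewrite /s tbracketDl tdiffD tdiff_diff add0r (tdiff_bracket _ ty) expr1z scaleN1r.
  rewrite (tbracket_skew (subtens_tdeg hdf) ty) (tbracket_skew (subtens_tdeg hyf) ty).
  rewrite mul0r expr0z !scale1r yyf opprB [- _ - _]addrC addrA subrK -opprD.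
  by rewrite -tbracketZl -tbracketDl addrC mc tbracket0l oppr0.
have [N HN] := maxid_nilpotent A.
rewrite (@gauge_sum _ _ _ N HN s y N) ?leqnSn //; last exact: tpart_F hs.
rewrite big1 ?addr0 // => i _; rewrite s0.
suff -> : iter i (tbracket s) 0 = 0 by rewrite scaler0.
by elim: (nat_of_ord i) => [//|j /= ->]; rewrite tbracket0r.
Qed.

End CurvatureIdentities.

(** * Successive approximation *)

Section GaugeMap.
Variables (K : fieldType) (L N : dgla K) (A B : art K) (phi : dgla_hom L N) (f : art_hom A B).

Lemma tens_map_gauge (a x : tens L A) : tpart 0 a ->
  tens_map phi f (gauge a x) = gauge (tens_map phi f a) (tens_map phi f x).
Proof.
move=> ha; have [n HA] := maxid_nilpotent A; have [n' HB] := maxid_nilpotent B.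
have hTa := tens_map_tpart phi f ha.
rewrite (@gauge_sum _ _ _ n HA a x (n + n')); [|exact: tpart_F ha|by lia].
rewrite (@gauge_sum _ _ _ n' HB _ _ (n + n')); [|exact: tpart_F hTa|by lia].
rewrite linearD linear_sum; congr (_ + _); apply: eq_bigr => i _.
rewrite linearZ /=; congr (_ *: _); elim: (nat_of_ord i) => [|j ih].
  by rewrite linearB /= tens_map_tbracket tens_map_tdiff.
by rewrite !iterS tens_map_tbracket ih.
Qed.

Lemma tens_mapD (x y : tens L A) :
  tens_map phi f (x + y) = tens_map phi f x + tens_map phi f y.
Proof. exact: linearD. Qed.

Lemma tens_mapB (x y : tens L A) :
  tens_map phi f (x - y) = tens_map phi f x - tens_map phi f y.
Proof. exact: linearB. Qed.

Lemma tens_map_curvature (x : tens L A) :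
  tens_map phi f (curvature x) = curvature (tens_map phi f x).
Proof.
by rewrite /curvature linearD linearZ /= tens_map_tdiff tens_map_tbracket.
Qed.

End GaugeMap.

Section Approximation.
Variables (K : fieldType) (A : art K).
Hypothesis charK : [pchar K] =i pred0.

(** Ideals [Q' <= Q <= m] with [m Q <= Q']: modulo [Q'], brackets of elements with
    coefficients in [Q] and in the maximal ideal vanish. *)
Variables (Q Q' : set A).
Hypotheses (hQ : is_ideal Q) (hQ' : is_ideal Q') (QQ' : Q' `<=` Q)
  (Qm : Q `<=` @maxid K A) (mQ : forall a b, maxid a -> Q b -> Q' (a * b)).

Let sQ : submodule Q.
Proof. exact/subspace_submodule/ideal_sub. Qed.
Let sQ' : submodule Q'.
Proof. exact/subspace_submodule/ideal_sub. Qed.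

Section OneAlgebra.
Variable L : dgla K.
Local Notation T := (tens L A).
Local Notation TQ i := (subtens (@degree K L i) Q).
Local Notation TQ' i := (subtens (@degree K L i) Q').

Let smod i (R : set A) : submodule (subtens (@degree K L i) R).
Proof. exact/subtens_submodule/degree_submodule. Qed.

Lemma TQ_tpart i (x : T) : TQ i x -> tpart i x.
Proof. exact: subtens_subset. Qed.

Lemma TQ'_TQ i (x : T) : TQ' i x -> TQ i x.
Proof. exact: subtens_subset. Qed.

Lemma tbracket_mQ i j (x y : T) : tpart i x -> TQ j y -> TQ' (i + j) (tbracket x y).
Proof. exact: tbracket_degree. Qed.

Lemma tbracket_Qm i j (x y : T) : TQ i x -> tpart j y -> TQ' (i + j) (tbracket x y).
Proof. by apply: tbracket_degree => a b Qa mb; rewrite mulrC; exact: mQ. Qed.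

(** Curvature and gauge action are affine in the perturbation, modulo [Q']. *)
Lemma curvature_perturb (x u : T) : tpart 1 x -> TQ 1 u ->
  TQ' 2 (curvature (x + u) - curvature x - tdiff u).
Proof.
move=> hx hu; have [_ D Z] := smod 2 Q'.
rewrite (curvatureD charK (subtens_tdeg hx) (subtens_tdeg hu)) [_ - curvature x]addrC addKr.
rewrite [_ - tdiff u]addrC addKr.
apply: D; first exact: tbracket_mQ hx hu.
by apply: Z; exact: tbracket_mQ (TQ_tpart hu) hu.
Qed.

Lemma gauge_perturb (b x : T) : tpart 1 x -> TQ 0 b ->
  TQ' 1 (gauge b x - (x - tdiff b)).
Proof.
move=> hx hb; have [T0 D Z] := smod 1 Q'; have [N HN] := maxid_nilpotent A.
have hbm := TQ_tpart hb.
rewrite (@gauge_sum _ _ _ N.+1 (fun n h => HN n (ltnW h)) b x N.+1) ?leqnSn //; last exact: tpart_F hbm.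
rewrite big_ord_recl /= exp_coef1 scale1r opprB [x + _]addrC -addrA [x + _]addrCA subrr addr0.
rewrite addrAC subrK; apply: D; first exact: tbracket_Qm hb hx.
apply: submodule_sum; first exact: smod.
move=> i _; apply: Z; elim: (nat_of_ord i) => [|j ih]; last first.
  exact: (tbracket_Qm hb (TQ_tpart (TQ'_TQ ih))).
have h : tpart 1 (tbracket b x - tdiff b).
  apply: (submoduleB (@tpart_submodule _ L A 1)); last exact: (@tdiff_subtens _ _ _ 0 _ _ hbm).
  exact: (TQ_tpart (TQ'_TQ (tbracket_Qm hb hx))).
exact: tbracket_Qm hb h.
Qed.

Lemma curvature_closed (x : T) : tpart 1 x -> TQ 2 (curvature x) -> TQ' 3 (tdiff (curvature x)).
Proof.
move=> hx hq; rewrite (tdiff_curvature charK (subtens_tdeg hx)).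
by apply: submoduleN; [exact: smod|exact: tbracket_mQ hx hq].
Qed.

Lemma curvature_correct (x v : T) : tpart 1 x -> TQ 1 v ->
  TQ' 2 (curvature x - tdiff v) -> TQ' 2 (curvature (x - v)).
Proof.
move=> hx hv hq; have [_ D _] := smod 2 Q'.
have hv' : TQ 1 (- v) by apply: submoduleN.
have := D _ _ (curvature_perturb hx hv') hq.
by rewrite tdiffN opprK addrACA subrK subrr addr0.
Qed.

End OneAlgebra.

Section Morphism.
Variables (L N : dgla K) (phi : dgla_hom L N).

(** The morphism [phi], extended to tensors with values in [A]. *)
Definition tphi (x : tens L A) : tens N A := tens_map phi (art_id A) x.

Lemma tphi_linear : linear tphi.
Proof. exact: tens_map_linear. Qed.

HB.instance Definition _ := GRing.isLinear.Build K (tens L A) (tens N A) *:%R tphi tphi_linear.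

Lemma tphi_tdiff x : tphi (tdiff x) = tdiff (tphi x).
Proof. exact: tens_map_tdiff. Qed.

Lemma tphi_curvature x : tphi (curvature x) = curvature (tphi x).
Proof. exact: tens_map_curvature. Qed.

Lemma tphi_subtens i (R : set A) x :
  subtens (degree i) R x -> subtens (degree i) R (tphi x).
Proof.
apply: tens_map_subtens => //; first exact: degree_submodule.
exact: dgla_fun_degree.
Qed.

(** If [x] satisfies the Maurer-Cartan equation modulo [Q] and lifts [y] modulo
    [Q], then [x] can be corrected by an element of [Q], and [y] by a gauge
    transformation in [Q], so that both hold modulo [Q']. *)
Lemma approximation_step (x : tens L A) (y : tens N A) :
  surjective (cohomology_map phi 1) -> injective (cohomology_map phi 2) ->
  tpart 1 x -> subtens (degree 2) Q (curvature x) -> MC y ->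
  subtens (degree 1) Q (tphi x - y) ->
  exists x' b, [/\ subtens (degree 1) Q (x' - x), subtens (degree 2) Q' (curvature x'),
    subtens (degree 0) Q b & subtens (degree 1) Q' (tphi x' - gauge b y)].
Proof.
move=> surj inj hx hq [hy mcy] hu; set u := tphi x - y in hu.
have smod (M : dgla K) i (R : set A) : submodule (subtens (@degree K M i) R).
  exact/subtens_submodule/degree_submodule.
have toT (M : dgla K) i (z : tens M A) : subtens (degree i) Q' z -> subtens setT Q' z.
  exact: subtens_subset.
(* The curvature of [x] is a cocycle modulo [Q'] whose image is the coboundary of
   [u]; hence it is itself a coboundary. *)
have [v hv hqv] : exists2 v, subtens (degree 1) Q v &
    subtens (degree 2) Q' (curvature x - tdiff v).
  apply: (kuenneth_inj inj sQ sQ' hq (toT _ _ _ (curvature_closed hx hq)) (Q0 := Q) hu).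
  rewrite -/(tphi _) -/(tdiff _) tphi_curvature; apply: (toT _ 2).
  have := curvature_perturb hy hu; rewrite /u [y + _]addrC subrK.
  by rewrite [X in _ - X - _]mcy subr0.
have hv' : tpart 1 v := TQ_tpart hv.
pose x1 := x - v; have hx1 : tpart 1 x1 by apply: submoduleB => //; exact: (@tpart_submodule _ L A 1).
have hq1 : subtens (degree 2) Q' (curvature x1) := curvature_correct hx hv hqv.
pose u1 := tphi x1 - y.
have hu1 : subtens (degree 1) Q u1.
  have -> : u1 = u - tphi v by rewrite /u1 /x1 linearB addrAC.
  by apply: submoduleB => //; exact: tphi_subtens.
have hdu1 : subtens (degree 2) Q' (tdiff u1).
  have := curvature_perturb hy hu1; rewrite {1}/u1 [y + _]addrC subrK.
  rewrite [X in _ - X - _]mcy subr0 => h.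
  rewrite -[tdiff u1](subKr (curvature (tphi x1))).
  by apply: submoduleB => //; rewrite -tphi_curvature; exact: tphi_subtens.
(* Once [x1] is Maurer-Cartan modulo [Q'], the remaining defect [u1] is a cocycle. *)
have [w [b [hw dw hb hr]]] := kuenneth_surj surj sQ sQ' hu1 (toT _ _ _ hdu1).
exists (x1 - w), (- b); split.
- rewrite /x1 addrAC [x - v]addrC addrK -opprD; apply: submoduleN => //.
  by have [_ D _] := smod L 1 Q; exact: D.
- by apply: curvature_correct => //; rewrite [tdiff w]dw subr0.
- exact: submoduleN.
have hb' : subtens (degree 0) Q (- b) by exact: submoduleN.
have hg := gauge_perturb hy hb'.
have -> : tphi (x1 - w) - gauge (- b) y =
    u1 - (tphi w + tdiff b) - (gauge (- b) y - (y - tdiff (- b))).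
  rewrite tdiffN opprK linearB /= opprB [- (tphi w + _)]opprD /u1 [X in _ = X + _]addrACA -opprD addrA.
  by rewrite subrK.
exact: submoduleB.
Qed.

(** If [x] and [x'] agree modulo [Q] and their images are related by a gauge
    transformation in [Q], then [x] can be moved by a gauge transformation so that
    both hold modulo [Q']. *)
Lemma injectivity_step (x x' : tens L A) (a : tens N A) :
  surjective (cohomology_map phi 0) -> injective (cohomology_map phi 1) ->
  MC x -> MC x' -> subtens (degree 1) Q (x' - x) ->
  subtens (degree 0) Q a -> tphi x' = gauge a (tphi x) ->
  exists e b, [/\ tpart 0 e, subtens (degree 1) Q' (x' - gauge e x),
    subtens (degree 0) Q' b & tphi x' = gauge b (tphi (gauge e x))].
Proof.
move=> surj inj [hx mcx] mcx' hc ha xa; set c := x' - x in hc.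
have smod (M : dgla K) i (R : set A) : submodule (subtens (@degree K M i) R).
  exact/subtens_submodule/degree_submodule.
have toT (M : dgla K) i (z : tens M A) : subtens (degree i) Q' z -> subtens setT Q' z.
  exact: subtens_subset.
have mcy : MC (tphi x) by exact: (tens_map_MC phi (art_id A)).
set y := tphi x in xa mcy.
have hy : tpart 1 y by case: mcy.
have hdc : subtens (degree 2) Q' (tdiff c).
  have := curvature_perturb hx hc; rewrite {1}/c [x + _]addrC subrK.
  rewrite [X in X - _ - _]mcx'.2 [X in _ - X - _]mcx subrr sub0r => h.
  by rewrite -[tdiff c]opprK; exact: submoduleN.
have hphic : subtens (degree 1) Q' (tphi c - tdiff (- a)).
  have -> : tphi c - tdiff (- a) = gauge a y - (y - tdiff a).
    by rewrite /c linearB /= xa -/y tdiffN opprK opprB -addrA [- y + _]addrC.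
  exact: gauge_perturb.
have hNa : subtens (degree 0) Q (- a) by exact: submoduleN.
have [e he hce] := kuenneth_inj inj sQ sQ' hc (toT _ _ _ hdc) (Q0 := Q) hNa (toT _ _ _ hphic).
have hea : subtens (degree 0) Q (tphi e + a).
  by have [_ D _] := smod N 0 Q; apply: D => //; exact: tphi_subtens.
have hdea : subtens (degree 1) Q' (tdiff (tphi e + a)).
  have -> : tdiff (tphi e + a) = tphi c - tdiff (- a) - tphi (c - tdiff e).
    by rewrite [tphi (c - _)]linearB /= tphi_tdiff tdiffD tdiffN opprK opprB [RHS]addrC addrA subrK.
  by apply: submoduleB => //; exact: tphi_subtens.
have [w [f [hw dw hf hr]]] := kuenneth_surj surj sQ sQ' hea (toT _ _ _ hdea).
set r := _ - _ in hr.
pose e' := w - e; have he' : subtens (degree 0) Q e' by exact: submoduleB.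
have he'm : tpart 0 e' := TQ_tpart he'.
have hf' : subtens (degree (-1)) Q f := hf.
have hfm : tpart (-1) f := TQ_tpart hf'.
(* The coboundary [d f] is completed to an element [s] that fixes [y]. *)
pose s := tdiff f + tbracket y f.
have hyf : subtens (degree 0) Q' (tbracket y f) := tbracket_mQ hy hf'.
have hs : subtens (degree 0) Q s.
  have [_ D _] := smod N 0 Q; apply: D; last exact: TQ'_TQ.
  exact: (@tdiff_subtens _ _ _ (-1) _ _ hf').
have gs : gauge (- s) y = y.
  by rewrite -{1}(gauge_stabiliser charK mcy hfm) (gaugeK charK) //; exact: TQ_tpart.
have phi_e' : tphi (gauge e' x) = gauge (tphi e') y.
  exact: tens_map_gauge.
have hphie' : subtens (degree 0) Q (tphi e') by exact: tphi_subtens.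
have gm : subtens (degree 0) Q `<=` @tpart K N A 0 by move=> z; exact: TQ_tpart.
have hg : subtens (degree 0) Q' `<=` subtens (@degree K N 0) Q by move=> z; exact: TQ'_TQ.
have gh z z' : subtens (@degree K N 0) Q z -> subtens (degree 0) Q z' ->
    subtens (degree 0) Q' (tbracket z z').
  by move=> /TQ_tpart hz hz'; exact: (tbracket_mQ hz hz').
have [c1 [hc1 hc1' gc1]] := gauge_comp charK (smod N 0 Q) (smod N 0 Q') gm hg gh
  (submoduleN (smod N 0 Q) hs) (submoduleN (smod N 0 Q) hphie').
have [b [hb hb' gb]] := gauge_comp charK (smod N 0 Q) (smod N 0 Q') gm hg gh ha hc1.
exists e', b; split=> //.
- have -> : x' - gauge e' x = c - tdiff e - (gauge e' x - (x - tdiff e')).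
    rewrite /e' tdiffB [tdiff w]dw sub0r opprK opprB [x + tdiff e]addrC !addrA subrK.
    by rewrite /c subrK.
  by apply: submoduleB => //; exact: gauge_perturb.
- have [_ D _] := smod N 0 Q'.
  have -> : b = b - (a + c1) + (c1 - (- s - tphi e')) + (r - tbracket y f).
    have -> : r - tbracket y f = a + (- s - tphi e').
      rewrite /r /s /e' -/(tphi w) -/(tdiff f) linearB /= opprB [tphi e + a]addrC -!addrA.
      congr (_ + _); rewrite [RHS]addrCA; congr (_ + _).
      by rewrite -!opprD -addrA [tphi w + _]addrC.
    by rewrite -addrA [a + (_ - _)]addrC [X in _ + X]addrA subrK [c1 + a]addrC subrK.
  by apply: (D); [exact: D|exact: submoduleB].
- by rewrite phi_e' -gb -gc1 (gaugeK charK) ?gs //; exact: gm.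
Qed.

End Morphism.
End Approximation.

(** * The deformation functor *)

Section Orbits.
Variables (K : fieldType) (L : dgla K) (A : art K).
Hypothesis charK : [pchar K] =i pred0.
Local Notation T := (tens L A).
Implicit Types x y z : T.

Lemma gauge_orbit_refl x : gauge_orbit x x.
Proof.
exists 0; last by rewrite gauge0.
by case: (@tpart_submodule _ L A 0).
Qed.

Lemma gauge_orbit_sym x y : gauge_orbit x y -> gauge_orbit y x.
Proof.
move=> [a ha ->]; exists (- a); last by rewrite (gaugeK charK).
by apply: submoduleN => //; exact: tpart_submodule.
Qed.

Lemma gauge_orbit_trans y x z : gauge_orbit x y -> gauge_orbit y z -> gauge_orbit x z.
Proof.
move=> [a ha ->] [b hb ->].
by have [c hc e] := gauge_trans charK hb ha; exists c; rewrite ?e.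
Qed.

Lemma gauge_orbit_eq x y : gauge_orbit x y -> gauge_orbit x = gauge_orbit y.
Proof.
move=> xy; apply/seteqP; split=> z; last exact: gauge_orbit_trans.
by apply: gauge_orbit_trans; exact: gauge_orbit_sym.
Qed.

Lemma Def_class_eq x y (hx : MC x) (hy : MC y) :
  gauge_orbit x y -> Def_class hx = Def_class hy.
Proof. by move=> xy; apply: Def_obj_inj; exact: gauge_orbit_eq. Qed.

Lemma Def_class_orbit x y (hx : MC x) (hy : MC y) :
  Def_class hx = Def_class hy -> gauge_orbit x y.
Proof.
move=> /(congr1 sval) /= e.
by have := gauge_orbit_refl y; rewrite -e.
Qed.

Lemma Def_repr_orbit x (hx : MC x) : gauge_orbit x (Def_repr (Def_class hx)).
Proof. by apply: (Def_class_orbit (hx := hx) (hy := Def_repr_MC _)); rewrite Def_reprK. Qed.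

End Orbits.

Section DefMap.
Variable K : fieldType.
Hypothesis charK : [pchar K] =i pred0.

Lemma tens_map_orbit (L N : dgla K) (A B : art K) (phi : dgla_hom L N)
    (f : art_hom A B) (x y : tens L A) :
  gauge_orbit x y -> gauge_orbit (tens_map phi f x) (tens_map phi f y).
Proof.
move=> [a ha ->]; exists (tens_map phi f a); first exact: tens_map_tpart.
exact: tens_map_gauge.
Qed.

(** [Def_map] may be computed with any representative. *)
Lemma Def_mapE (L N : dgla K) (A B : art K) (phi : dgla_hom L N) (f : art_hom A B)
    (x : tens L A) (hx : MC x) :
  Def_map phi f (Def_class hx) = Def_class (tens_map_MC phi f hx).
Proof.
apply: Def_class_eq => //; apply: tens_map_orbit.
exact/gauge_orbit_sym/Def_repr_orbit.
Qed.

Lemma Def_ind (L : dgla K) (A : art K) (C : Def_obj L A -> Prop) :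
  (forall x (hx : MC x), C (Def_class hx)) -> forall c, C c.
Proof. by move=> h c; rewrite -(Def_reprK c). Qed.

Lemma tens_map_id (U V : lmodType K) (x : tens U V) : tens_map idfun idfun x = x.
Proof.
elim/tens_ind: x => [|x y hx hy|u v]; first exact: linear0.
  by rewrite linearD /= hx hy.
by rewrite tens_map_pure.
Qed.

Lemma tens_map_comp (L M N : dgla K) (A B C : art K) (phi : dgla_hom L M)
    (psi : dgla_hom M N) (f : art_hom A B) (g : art_hom B C) (x : tens L A) :
  tens_map psi g (tens_map phi f x) = tens_map (psi \o phi) (g \o f) x.
Proof.
elim/tens_ind: x => [|x y hx hy|u v]; first by rewrite !linear0.
  by rewrite !linearD /= hx hy.
by rewrite !tens_map_pure.
Qed.

Lemma Def_functor (L : dgla K) : is_functor (Def L).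
Proof.
split=> [A|A B C g f]; apply: Def_ind => x hx; rewrite /= !Def_mapE;
  apply: Def_class_eq => //.
  by rewrite [tens_map _ _ _](@tens_map_id L A x); exact: gauge_orbit_refl.
rewrite tens_map_comp; exact: gauge_orbit_refl.
Qed.

Lemma Def_mor_nat (L N : dgla K) (phi : dgla_hom L N) : is_nat_trans (Def_mor phi).
Proof.
split; [exact: Def_functor|exact: Def_functor|move=> A B f].
apply: Def_ind => x hx; rewrite /Def_mor /= !Def_mapE; apply: Def_class_eq => //.
by rewrite !tens_map_comp; exact: gauge_orbit_refl.
Qed.

Lemma Def_one_point (L : dgla K) : one_point (Def L art_field).
Proof.
have MC0 : MC (0 : tens L (@art_field K)).
  split; first by case: (@tpart_submodule _ L (@art_field K) 1).
  by rewrite linear0 tbracket0l scaler0 addr0.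
exists (Def_class MC0); apply: Def_ind => x hx; apply: Def_class_eq => //.
by have [/subtens_zero -> _] := hx; exact: gauge_orbit_refl.
Qed.

(** * Smoothness and bijectivity *)

Section MainResults.
Variables (L N : dgla K) (phi : dgla_hom L N).

Lemma art_hom_lift (B A : art K) (p : art_hom B A) a : surjective p -> maxid a ->
  exists2 b, maxid b & p b = a.
Proof.
move=> surj ma; have [b pb] := surj a; exists b => //.
have [c mc] := art_residue b.
suff c0 : c = 0 by move: mc; rewrite c0 scale0r subr0.
apply: (@maxid_scalar K A); have := art_fun_local p mc.
rewrite linearB linearZ /= rmorph1 pb => mac.
have hm : submodule (@maxid K A) by exact/subspace_submodule/ideal_sub/maxid_ideal.
rewrite -[c%:A](subKr a).
exact: submoduleB.
Qed.

Lemma tpart_lift (M : dgla K) (B A : art K) (p : art_hom B A) i (x : tens M A) :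
  surjective p -> tpart i x ->
  exists2 x' : tens M B, tpart i x' & tens_map (dgla_id M) p x' = x.
Proof.
move=> surj hx; have [B0 BD _] := @tpart_submodule _ M B i.
apply: (subtens_ind (C := fun x => exists2 x' : tens M B, tpart i x' &
  tens_map (dgla_id M) p x' = x)  _ _ _ hx).
- by exists 0 => //; exact: linear0.
- move=> y z [y' hy' <-] [z' hz' <-]; exists (y' + z'); first exact: BD.
  exact: linearD.
- move=> u a hu /(art_hom_lift surj)[b mb <-]; exists (pure u b).
    exact: subtens_pure.
  exact: tens_map_pure.
Qed.

Lemma Def_mor_smooth :
  surjective (cohomology_map phi 1) -> injective (cohomology_map phi 2) ->
  smooth (Def_mor phi).
Proof.
move=> surj1 inj2; split; [exact: Def_mor_nat|exact: Def_one_point|exact: Def_one_point|].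
move=> B A p [psurj pker]; apply: Def_ind => y hy; apply: Def_ind => x hx.
rewrite /Def_mor /= !Def_mapE => /Def_class_orbit[a ha xa].
pose J := [set b | p b = 0].
have hJ : is_ideal J.
  split=> [|b c /= b0 c0|b c /= c0]; first exact: rmorph0.
    by rewrite /J /= rmorphD /= b0 c0 addr0.
  by rewrite /J /= rmorphM /= c0 mulr0.
have J1 : ~ J 1 by rewrite /J /= rmorph1 => /eqP; rewrite oner_eq0.
have Jm := proper_ideal_maxid hJ J1.
have h0 : is_ideal [set 0 : B].
  by split=> //= [u v -> ->|u v ->]; rewrite ?addr0 ?mulr0.
have J0 : [set 0] `<=` J by case: hJ => J0 _ _ b ->.
have mJ b j : maxid b -> J j -> [set 0] (b * j) by exact: pker.
have sm (I : set B) : is_ideal I -> submodule I by move/ideal_sub/subspace_submodule.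
have ker (M : dgla K) i (z : tens M B) : tpart i z ->
    tens_map (dgla_id M) p z = 0 -> subtens (degree i) J z.
  by apply: tens_map_ker => //; [exact: degree_submodule|exact/sm/maxid_ideal].
have [a' ha' pa'] := tpart_lift psurj ha.
pose y' := gauge a' y; have hy' : MC y' := gauge_MC charK ha' hy.
have py' : tens_map (dgla_id N) p y' = tens_map phi (art_id A) x.
  by rewrite xa /y' tens_map_gauge // pa'.
have [x' hx' px'] := tpart_lift psurj hx.1.
have hq : subtens (degree 2) J (curvature x').
  apply: ker.
    have [_ D Z] := @tpart_submodule _ L B 2; apply: D; first exact: (tdiff_subtens hx').
    apply: Z; apply: (tbracket_degree _ hx' hx') => u v _ mv.
    by have [_ _ mM] := maxid_ideal B; exact: mM.
  rewrite tens_map_curvature px'; exact: hx.2.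
have hxy : subtens (degree 1) J (tphi phi x' - y').
  apply: ker.
    apply: submoduleB; [exact: tpart_submodule|exact: tphi_subtens|exact: hy'.1].
  by rewrite tens_mapB py' /tphi tens_map_comp -px' tens_map_comp; exact: subrr.
have [x'' [b [hx'' hq'' hb hxy'']]] :=
  approximation_step charK hJ h0 J0 Jm mJ surj1 inj2 hx' hq hy' hxy.
have hmc : MC x''.
  split; last exact: subtens_zero hq''.
  rewrite -(subrK x' x''); have [_ D _] := @tpart_submodule _ L B 1; apply: D => //.
  exact: subtens_subset hx''.
exists (Def_class hmc); rewrite /Def_mor /= Def_mapE; apply: Def_class_eq => //.
  apply: (gauge_orbit_sym charK); apply: (@gauge_orbit_trans _ _ _ charK y').
    by exists a'.
  exists b; first exact: subtens_subset hb.
  by apply/eqP; rewrite -subr_eq0; apply/eqP; exact: subtens_zero hxy''.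
have -> : tens_map (dgla_id L) p x'' = x; last exact: gauge_orbit_refl.
rewrite -(subrK x' x'') tens_mapD px' -[RHS]add0r; congr (_ + _).
have : subtens (degree 1) [set 0] (tens_map (dgla_id L) p (x'' - x')).
  by apply: tens_map_subtens hx'' => //; exact: degree_submodule.
exact: subtens_zero.
Qed.

Lemma Def_mor_surj (A : art K) :
  surjective (cohomology_map phi 1) -> injective (cohomology_map phi 2) ->
  surjective (Def_mor phi (A := A)).
Proof.
move=> surj1 inj2; apply: Def_ind => y hy; have [n Hn] := maxid_nilpotent A.
have [x [y' [hx hq hyy' hxy]]] : exists (x : tens L A) (y' : tens N A), [/\ tpart 1 x,
    subtens (degree 2) (@mpow K A n.+1) (curvature x), gauge_orbit y y' &
    subtens (degree 1) (@mpow K A n.+1) (tphi phi x - y')].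
  elim: n {Hn} => [|n [x [y' [hx hq hyy' hxy]]]].
    exists 0, y; rewrite mpow1 /curvature; split.
    - by case: (@tpart_submodule _ L A 1).
    - rewrite linear0 tbracket0l scaler0 addr0.
      by case: (@tpart_submodule _ L A 2).
    - exact: gauge_orbit_refl.
    - rewrite linear0 sub0r; apply: submoduleN; [exact: tpart_submodule|exact: hy.1].
  have hy' : MC y' by have [a ha ->] := hyy'; exact: gauge_MC.
  have [x' [b [hx' hq' hb hxy']]] := approximation_step charK (mpow_ideal A n.+1)
    (mpow_ideal A n.+2) (@mpowS _ A n.+1) (@mpow_maxid _ A n)
    (@idealM_mul _ A (@maxid K A) (mpow n.+1)) surj1 inj2 hx hq hy' hxy.
  exists x', (gauge b y'); split=> //.
    rewrite -(subrK x x'); have [_ D _] := @tpart_submodule _ L A 1; apply: D => //.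
    by apply: subtens_subset hx' => //; exact: mpow_maxid.
  apply: (gauge_orbit_trans charK hyy'); exists b => //.
  by apply: subtens_subset hb => //; exact: mpow_maxid.
move: hq hxy; rewrite Hn // => /subtens_zero hq /subtens_zero/eqP.
rewrite subr_eq0 => /eqP hxy; exists (Def_class (conj hx hq : MC x)).
rewrite /Def_mor Def_mapE; apply: Def_class_eq => //.
by rewrite -[tens_map _ _ _]/(tphi phi x) hxy; exact: gauge_orbit_sym.
Qed.

Lemma Def_mor_inj (A : art K) :
  surjective (cohomology_map phi 0) -> injective (cohomology_map phi 1) ->
  injective (Def_mor phi (A := A)).
Proof.
move=> surj0 inj1; apply: Def_ind => x hx; apply: Def_ind => x' hx'.
rewrite /Def_mor !Def_mapE => /Def_class_orbit[a ha xa].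
have [n Hn] := maxid_nilpotent A.
suff [z [xz hz]] : exists z : tens L A, gauge_orbit x z /\
    subtens (degree 1) (@mpow K A n.+1) (x' - z).
  apply: Def_class_eq => //; move: hz; rewrite Hn // => /subtens_zero/eqP.
  by rewrite subr_eq0 => /eqP ->.
suff [z [b [xz hz _ _]]] : exists (z : tens L A) (b : tens N A), [/\ gauge_orbit x z,
    subtens (degree 1) (@mpow K A n.+1) (x' - z),
    subtens (degree 0) (@mpow K A n.+1) b & tphi phi x' = gauge b (tphi phi z)].
  by exists z.
elim: n {Hn} => [|n [z [b [xz hz hb zb]]]].
  exists x, a; rewrite mpow1; split=> //; first exact: gauge_orbit_refl.
  by apply: submoduleB; [exact: tpart_submodule|exact: hx'.1|exact: hx.1].
have mz : MC z by have [c hc ->] := xz; exact: gauge_MC.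
have [e [b' [he hz' hb' zb']]] := injectivity_step charK (mpow_ideal A n.+1)
  (mpow_ideal A n.+2) (@mpowS _ A n.+1) (@mpow_maxid _ A n)
  (@idealM_mul _ A (@maxid K A) (mpow n.+1)) surj0 inj1 mz hx' hz hb zb.
exists (gauge e z), b'; split=> //; apply: (gauge_orbit_trans charK xz).
by exists e.
Qed.

End MainResults.
End DefMap.

Theorem theoremV51 (K : fieldType) (charK : [pchar K] =i pred0)
    (L N : dgla K) (phi : dgla_hom L N) :
  (surjective (cohomology_map phi 1) ->
   injective (cohomology_map phi 2) ->
   smooth (Def_mor phi)) /\
  (surjective (cohomology_map phi 0) ->
   bijective (cohomology_map phi 1) ->
   injective (cohomology_map phi 2) ->
   nat_iso (Def_mor phi)).
Proof.
split; first exact: Def_mor_smooth.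
move=> surj0 bij1 inj2; split; first exact: Def_mor_nat.
have [g gK Kg] := bij1.
have surj1 : surjective (cohomology_map phi 1) by move=> c; exists (g c).
move=> A; have surj := Def_mor_surj charK (A := A) surj1 inj2.
pose h c := sval (cid (surj c)).
have hK c : Def_mor phi (h c) = c by rewrite /h; case: cid.
exists h => // c; apply: (Def_mor_inj charK surj0 (bij_inj bij1)); exact: hK.
Qed.
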